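(* For any $n\ge0$, there exists a decorated tree $T_n$ with $n$ non-gray vertices such that $d_{S(T_n)}=n$ and $S(T_n)(\frac14)$ is a polynomial in $1/\pi$ of degree $\lfloor n/2\rfloor$.
   Context: A decorated tree is a finite rooted tree $T$ in which each vertex $v$ carries a triple $(\varepsilon_v,\bowtie_v,K_v)\in\{-1,0,1\}\times\{=,\le,\ge,\varnothing\}\times\mathbb{Z}$. Vertices with $\varepsilon_v=-1,0,1$ are called black, gray, white respectively (the coloring need not be proper). Write $v'\le_T v$ if $v'$ is a descendant of $v$ (including $v'=v$). Attach a variable $m_b$ to each black vertex $b$ and a variable $\ell_w$ to each white vertex $w$ (none to gray vertices). To each vertex $v$ associate the condition $$(C_v)\quad \Big(\sum_{w\le_T v,\ \varepsilon_w=1}\ell_w-\sum_{b\le_T v,\ \varepsilon_b=-1}m_b\Big)\ \bowtie_v\ \sum_{v'\le_T v}K_{v'},$$ which is void (always satisfied) if $\bowtie_v=\varnothing$. With $\mathrm{Cat}_n=\frac1{n+1}\binom{2n}{n}$, define the power series $$S(T)=S(T)(t)=\sum_{(\ell_w),(m_b)}\ \prod_{w:\varepsilon_w=1}\mathrm{Cat}_{\ell_w}t^{\ell_w}\prod_{b:\varepsilon_b=-1}\mathrm{Cat}_{m_b}t^{m_b}\prod_{v}\mathbf 1[C_v],$$ the sum being over tuples of nonnegative integers. It converges at $t=1/4$. Polynomials in $1/\pi$ have rational coefficients. For real $a,b,c$ with $c$ not a nonpositive integer, ${}_2F_1(a,b;c;z)=\sum_{n\ge0}\frac{(a)_n(b)_n}{(c)_n}\frac{z^n}{n!}$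 with $(x)_n=x(x+1)\cdots(x+n-1)$. Set $H_1(t)={}_2F_1(-\tfrac12,-\tfrac12;1;16t^2)$, $H_2(t)={}_2F_1(-\tfrac12,\tfrac12;2;16t^2)$, $\mathcal{A}=\mathbb{Q}[t,t^{-1},H_1(t),H_2(t)]$, $\mathcal{B}=\mathcal{A}[\sqrt{1-4t}]$, viewed as algebras of Laurent series in $t$; $S(T)\in\mathcal{B}$ for every decorated tree $T$. The degree $d_b$ of $b\in\mathcal{B}$ is the minimal degree of a polynomial expression of $b$ in $H_1(t),H_2(t),\sqrt{1-4t}$ with coefficients in $\mathbb{Q}[t,t^{-1}]$, where $H_1(t)$ and $H_2(t)$ are given degree $2$, $\sqrt{1-4t}$ is given degree $1$, and Laurent polynomials in $t$ have degree $0$. *)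

(* Defs.v *)
From HB Require Import structures.
From mathcomp Require Import all_boot all_order all_algebra.
From mathcomp Require Import boolp.
From mathcomp Require Import mpoly ring zify.

Set Implicit Arguments.
Unset Strict Implicit.
Unset Printing Implicit Defensive.

Import Order.TTheory GRing.Theory Num.Theory.
Local Open Scope ring_scope.

(* eps = -1, 0, 1 respectively *)
Inductive color := Black | Gray | White.
Inductive relsign := RelEq | RelLe | RelGe | RelVoid.

Definition is_black c := if c is Black then true else false.
Definition is_gray c := if c is Gray then true else false.
Definition is_white c := if c is White then true else false.

(* A rooted tree is given by its parent map, the root being its own parent:   *)
(* since every vertex reaches the root by iterating [par], the root is the    *)
(* only vertex lying on a cycle of [par].                                     *)
Record dtree := DTree {
  vertex :> finType;
  troot : vertex;
  par : vertex -> vertex;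
  par_troot : par troot = troot;
  par_connect : forall v, fconnect par v troot;
  eps : vertex -> color;
  rel_of : vertex -> relsign;
  wt : vertex -> int }.
Arguments par {d}.
Arguments eps {d}.
Arguments rel_of {d}.
Arguments wt {d}.

Definition sat_rel (r : relsign) (x y : int) : bool :=
  match r with
  | RelEq => x == y
  | RelLe => x <= y
  | RelGe => y <= x
  | RelVoid => true
  end.

Section TreeSeries.
Variable T : dtree.

Definition desc (v' v : T) : bool := fconnect par v' v.

(* A single map [x] carries both families of variables: x w is l_w if w is    *)
(* white, and x b is m_b if b is black.                                       *)
Definition cond (x : T -> nat) (v : T) : bool :=
  sat_rel (rel_of v)
    (\sum_(w : T | desc w v && is_white (eps w)) (x w)%:Z -
     \sum_(b : T | desc b v && is_black (eps b)) (x b)%:Z)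
    (\sum_(v' : T | desc v' v) wt v').

Definition Cat (n : nat) : rat := ('C(n.*2, n))%:R / (n.+1)%:R.

(* The coefficient of t^N sums over the assignments with total N, so each     *)
(* variable is at most N; gray vertices carry no variable and are assigned 0. *)
Definition tree_coef (N : nat) : rat :=
  \sum_(x : {ffun T -> 'I_N.+1} |
          [&& [forall v, is_gray (eps v) ==> (x v == ord0)],
              (\sum_v (x v : nat))%N == N
            & [forall v, cond (fun u => x u) v]])
     \prod_(v : T | ~~ is_gray (eps v)) Cat (x v).

Definition num_nongray : nat := #|[pred v : T | ~~ is_gray (eps v)]|.

End TreeSeries.

(* FPS f is the formal power series \sum_n f n t^n over Q. *)
Record fps := FPS { fcoef : nat -> rat }.

Lemma fcoefK : cancel fcoef FPS. Proof. by case. Qed.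

HB.instance Definition _ := Equality.copy fps (can_type fcoefK).
HB.instance Definition _ := Choice.copy fps (can_type fcoefK).

Lemma fpsP (f g : fps) : fcoef f =1 fcoef g <-> f = g.
Proof.
split=> [|-> //]; case: f => f; case: g => g /= fg.
by congr FPS; apply: funext.
Qed.

Definition fps0 := FPS (fun=> 0).
Definition fps_opp f := FPS (fun n => - fcoef f n).
Definition fps_add f g := FPS (fun n => fcoef f n + fcoef g n).

Fact fps_addA : associative fps_add.
Proof. by move=> f g h; apply/fpsP => n /=; rewrite addrA. Qed.
Fact fps_addC : commutative fps_add.
Proof. by move=> f g; apply/fpsP => n /=; rewrite addrC. Qed.
Fact fps_add0 : left_id fps0 fps_add.
Proof. by move=> f; apply/fpsP => n /=; rewrite add0r. Qed.
Fact fps_addN : left_inverse fps0 fps_opp fps_add.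
Proof. by move=> f; apply/fpsP => n /=; rewrite addNr. Qed.

HB.instance Definition _ :=
  GRing.isZmodule.Build fps fps_addA fps_addC fps_add0 fps_addN.

Definition fps_poly (p : {poly rat}) := FPS (fun n => p`_n).
Definition fps_mul f g :=
  FPS (fun n => \sum_(i < n.+1) fcoef f i * fcoef g (n - i)).

Definition fps_trunc n f : {poly rat} := \poly_(i < n.+1) fcoef f i.

Lemma coef_fps_trunc n f i : (i <= n)%N -> (fps_trunc n f)`_i = fcoef f i.
Proof. by move=> le_in; rewrite coef_poly ltnS le_in. Qed.

Lemma coef_truncM n f g i : (i <= n)%N ->
  (fps_trunc n f * fps_trunc n g)`_i = fcoef (fps_mul f g) i.
Proof.
move=> le_in; rewrite coefM /=; apply: eq_bigr => j _.
by rewrite !coef_fps_trunc //; move: (ltn_ord j); lia.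
Qed.

Fact fps_mulC : commutative fps_mul.
Proof.
move=> f g; apply/fpsP => n.
by rewrite -!(@coef_truncM n) // mulrC.
Qed.

Fact fps_mulA : associative fps_mul.
Proof.
move=> f g h; apply/fpsP => n.
have -> : fcoef (fps_mul f (fps_mul g h)) n
        = (fps_trunc n f * (fps_trunc n g * fps_trunc n h))`_n.
  rewrite coefM /=; apply: eq_bigr => j _.
  by rewrite (@coef_truncM n) ?coef_fps_trunc ?leq_subr // -ltnS.
rewrite mulrA coefM /=; apply: eq_bigr => j _.
by rewrite (@coef_truncM n) ?coef_fps_trunc ?leq_subr // -ltnS.
Qed.

Fact fps_mul1 : left_id (fps_poly 1) fps_mul.
Proof.
move=> f; apply/fpsP => n /=.
rewrite big_ord_recl /= coef1 mul1r subn0 big1 ?addr0 // => i _.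
by rewrite coef1 mul0r.
Qed.

Fact fps_mulDl : left_distributive fps_mul fps_add.
Proof.
move=> f g h; apply/fpsP => n /=.
by rewrite -big_split; apply: eq_bigr => i _; rewrite mulrDl.
Qed.

Fact fps_1_neq0 : fps_poly 1 != 0.
Proof.
apply/eqP => /fpsP /(_ 0%N) /=; rewrite coef1 /= => /eqP.
by rewrite oner_eq0.
Qed.

HB.instance Definition _ := GRing.Zmodule_isComNzRing.Build fps
  fps_mulA fps_mulC fps_mul1 fps_mulDl fps_1_neq0.

Lemma fcoef0 n : fcoef 0 n = 0. Proof. by []. Qed.
Lemma fcoef1 n : fcoef 1 n = (n == 0%N)%:R. Proof. by rewrite -coef1. Qed.
Lemma fcoefD f g n : fcoef (f + g) n = fcoef f n + fcoef g n.
Proof. by []. Qed.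
Lemma fcoefN f n : fcoef (- f) n = - fcoef f n. Proof. by []. Qed.
Lemma fcoefM f g n :
  fcoef (f * g) n = \sum_(i < n.+1) fcoef f i * fcoef g (n - i).
Proof. by []. Qed.

Definition fps_unit : pred fps := fun f => `[< exists g, g * f = 1 >].
Definition fps_inv (f : fps) : fps :=
  if pselect (exists g, g * f = 1) is left h then projT1 (cid h) else f.

Fact fps_mulVf : {in fps_unit, left_inverse 1 fps_inv *%R}.
Proof.
move=> f /asboolP fU; rewrite /fps_inv.
by case: pselect => // h; case: (cid h).
Qed.

Fact fps_unitP f g : g * f = 1 -> fps_unit f.
Proof. by move=> gf1; apply/asboolP; exists g. Qed.

Fact fps_invr_out : {in [predC fps_unit], fps_inv =1 id}.
Proof.
by move=> f /asboolP fNU; rewrite /fps_inv; case: pselect.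
Qed.

HB.instance Definition _ := GRing.ComNzRing_hasMulInverse.Build fps
  fps_mulVf fps_unitP fps_invr_out.

Fact fps_idomain : GRing.integral_domain_axiom fps.
Proof.
have lead (f : fps) : f != 0 ->
    exists n, fcoef f n != 0 /\ forall i, (i < n)%N -> fcoef f i = 0.
  move=> f0; have exf : exists n, fcoef f n != 0.
    apply: contrapT => nex; case/eqP: f0; apply/fpsP => n.
    by apply/eqP; apply: contrapT => /negP fn; apply: nex; exists n.
  case: (ex_minnP exf) => n fn min; exists n; split=> // i lt_in.
  by apply/eqP; apply: contraTT lt_in => fi; rewrite -leqNgt min.
move=> f g fg0; rewrite -[_ || _]negbK negb_or.
apply/negP => /andP[/lead[m [fm lm]] /lead[n [gn ln]]].
have /fpsP/(_ (m + n)%N) := fg0; rewrite fcoefM fcoef0.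
have ltm : (m < (m + n).+1)%N by rewrite ltnS leq_addr.
rewrite (bigD1 (Ordinal ltm)) //= big1 ?addr0.
  by rewrite addKn => /eqP; rewrite mulf_eq0 (negPf fm) (negPf gn).
move=> i im; have {}im : (i : nat) != m by apply: contraNneq im => im; apply/eqP/val_inj.
case: (ltnP i m) => [/lm -> | mi]; first by rewrite mul0r.
by rewrite [X in _ * X]ln ?mulr0 //; move: (ltn_ord i); lia.
Qed.

HB.instance Definition _ := GRing.ComUnitRing_isIntegral.Build fps fps_idomain.

Definition tree_series (T : dtree) : fps := FPS (@tree_coef T).

(* Laurent series: Q((t)) is the fraction field of Q[[t]].                    *)

Definition laurent := {fraction fps}.
Definition to_laurent (f : fps) : laurent := tofrac f.
Definition tvar : laurent := to_laurent (fps_poly 'X).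

Definition is_laurent_poly (c : laurent) : Prop :=
  exists (p : {poly rat}) (m : nat), c = to_laurent (fps_poly p) / tvar ^+ m.

Definition poch (x : rat) (n : nat) : rat := \prod_(i < n) (x + i%:R).

Definition hyp2F1_coef (a b c : rat) (n : nat) : rat :=
  poch a n * poch b n / (poch c n * (n`!)%:R).

(* 2F1(a, b; c; 16 t^2) *)
Definition hyp2F1_16t2 (a b c : rat) : fps :=
  FPS (fun n => if odd n then 0 else hyp2F1_coef a b c n./2 * 16%:R ^+ n./2).

Definition H1 : fps := hyp2F1_16t2 (- (1 / 2)) (- (1 / 2)) 1.
Definition H2 : fps := hyp2F1_16t2 (- (1 / 2)) (1 / 2) 2.

(* The binomial series (1 - z)^(1/2) = \sum_n (-1/2)_n z^n / n! at z = 4t; its *)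
(* square is 1 - 4t by sqrt14E and its constant term is 1.                    *)
Definition sqrt14 : fps :=
  FPS (fun n => poch (- (1 / 2)) n / (n`!)%:R * 4%:R ^+ n).

Lemma fcoef_sqrt14_0 : fcoef sqrt14 0 = 1.
Proof. by rewrite /= /poch big_ord0 fact0 divr1 mul1r. Qed.

Lemma sqrt14_rec n : n.+1%:R * fcoef sqrt14 n.+1 =
  (4%:R * n%:R - 2%:R) * fcoef sqrt14 n.
Proof.
rewrite /= /poch big_ord_recr /= factS natrM exprS.
have n1 : n.+1%:R != 0 :> rat by rewrite pnatr_eq0.
have nf : (n`!)%:R != 0 :> rat by rewrite pnatr_eq0 -lt0n fact_gt0.
by field; rewrite nf addrC natr1 n1.
Qed.

Lemma sqr_rec (s : nat -> rat) (u := fun n => \sum_(i < n.+1) s i * s (n - i)%N) :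
    (forall n, n.+1%:R * s n.+1 = (4%:R * n%:R - 2%:R) * s n) ->
  forall n, n.+1%:R * u n.+1 = (4%:R * n%:R - 4%:R) * u n.
Proof.
move=> s_rec n.
have half : n.+1%:R * u n.+1 =
    (\sum_(i < n.+2) i%:R * (s i * s (n.+1 - i)%N)) *+ 2.
  have -> : n.+1%:R * u n.+1 = \sum_(i < n.+2) i%:R * (s i * s (n.+1 - i)%N)
      + \sum_(i < n.+2) (n.+1 - i)%:R * (s i * s (n.+1 - i)%N).
    rewrite -big_split mulr_sumr; apply: eq_bigr => i _ /=.
    by rewrite -mulrDl -natrD subnKC // -ltnS.
  rewrite mulr2n; congr (_ + _); rewrite (reindex_inj rev_ord_inj) /=.
  apply: eq_bigr => i _; rewrite subSS subKn -1?ltnS //.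
  by rewrite [s _ * s i]mulrC.
rewrite half big_ord_recl /= mul0r add0r.
under eq_bigr => i _ do rewrite /bump /= add1n subSS mulrA s_rec.
rewrite mulr2n [X in _ + X](reindex_inj rev_ord_inj) -big_split.
rewrite mulr_sumr; apply: eq_bigr => i _ /=.
have le_in : (i <= n)%N by rewrite -ltnS.
by rewrite subSS subKn // natrB //; ring.
Qed.

Lemma sqrt14E : sqrt14 ^+ 2 = fps_poly (1 - 4%:R *: 'X).
Proof.
have u_rec := sqr_rec sqrt14_rec.
have u0 : fcoef (sqrt14 ^+ 2) 0 = 1.
  by rewrite expr2 fcoefM big_ord1 subnn fcoef_sqrt14_0 mulr1.
move: u0; rewrite expr2; set u := fcoef (sqrt14 * sqrt14) => u0.
have {}u_rec n : n.+1%:R * u n.+1 = (4%:R * n%:R - 4%:R) * u n by exact: u_rec.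
apply/fpsP; rewrite -/u; move: u u0 u_rec => u u0 u_rec n.
have u1 : u 1%N = - 4%:R.
  by move: (u_rec 0%N); rewrite u0 mul1r => ->; rewrite mulr0 sub0r mulr1.
have -> : fcoef (fps_poly (1 - 4%:R *: 'X)) n
        = (n == 0%N)%:R - 4%:R * (n == 1%N)%:R.
  by rewrite [LHS]coefB coefZ coef1 coefX.
case: n => [|[|n]] /=; first by rewrite u0 mulr0 subr0.
  by rewrite u1 mulr1 sub0r.
rewrite mulr0 subr0; elim: n => [|n IHn]; apply/eqP.
  move/eqP: (u_rec 1%N); rewrite mulr1 subrr mul0r mulf_eq0.
  by rewrite pnatr_eq0.
by move/eqP: (u_rec n.+2); rewrite IHn mulr0 mulf_eq0 pnatr_eq0.
Qed.

Definition Bgen : 'I_3 -> laurent :=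
  tnth [tuple to_laurent H1; to_laurent H2; to_laurent sqrt14].
Definition Bgen_deg : 'I_3 -> nat := tnth [tuple 2; 2; 1].

Definition wdeg (P : {mpoly laurent[3]}) : nat :=
  (\max_(m <- msupp P) \sum_(i < 3) Bgen_deg i * m i)%N.

(* The coefficients of a polynomial expression lie in Q[t, 1/t], not merely in *)
(* Q((t)).                                                                    *)
Definition is_expression (b : laurent) (P : {mpoly laurent[3]}) : Prop :=
  (forall m, is_laurent_poly P@_m) /\ P.@[Bgen] = b.

Definition has_degree (b : laurent) (d : nat) : Prop :=
  (exists2 P, is_expression b P & wdeg P = d) /\
  (forall P, is_expression b P -> (d <= wdeg P)%N).

(* Main.v *)
(* The tree T_n has a gray root carrying n/2 pairs (a white vertex with sign =  *)
(* and K = 0, with a black child) and, for odd n, a white leaf, so that S(T_n)  *)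
(* is E^(n/2) C^(odd n), where E = sum Cat_l^2 t^(2l) = (H1 - 1)/(4t^2) and     *)
(* C = (1 - sqrt(1 - 4t))/(2t). At t = 1/4 both partial sums are explicit, and  *)
(* the Wallis product gives E(1/4) = 16/pi - 4 and C(1/4) = 2.                  *)
(*   The degree is bounded below by reduction modulo a large prime p. Let A be  *)
(* sum binom(2l,l)^2 x^l with x = t^2, and let a be its truncation at x^p. By   *)
(* the Lucas congruence A = a A^p mod p, so that a A' = a' A; as H1 and H2 are  *)
(* linear combinations of A and A' over Q(x), modulo p both are multiples of A  *)
(* by rational functions. An expression of E^k C^e of weight < 2k + e would     *)
(* then give f0(A) + s f1(A) = 0 with s = sqrt(1 - 4t), deg f0, deg f1 <= k,    *)
(* and a nonzero coefficient of A^k in f_e. Hence f0^2 - (1 - 4t) f1^2 kills A. *)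
(* But the p-th power of a relation sum c_j A^j = 0 of least degree m is, by    *)
(* A^p = A/a, another one, and comparing them gives c_0^(p-1) a^m = c_m^(p-1).  *)
(* This is impossible for 0 < m < p - 1 since a is squarefree: its common       *)
(* factors with a' divide every derivative of a, by the hypergeometric          *)
(* differential equation.                                                       *)

Require Import Defs.
From HB Require Import structures.
From mathcomp Require Import all_boot all_order all_algebra.
From mathcomp Require Import classical_sets reals topology normedtype sequences trigo.
From mathcomp Require Import boolp ring zify lra.
From mathcomp Require mpoly derive functions.
Import -(notations) mpoly.
Import -(notations) derive.
Set Implicit Arguments.
Unset Strict Implicit.
Unset Printing Implicit Defensive.
Import Order.TTheory GRing.Theory Num.Theory.
Import numFieldNormedType.Exports.
Local Open Scope ring_scope.

(** Write E for [catalan_sqr_series], C for [catalan_series], s for sqrt(1 - 4t) and n = 2k + e with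
    e in {0, 1}. Each equality sign in [pair_tree] ties a white vertex to its black child, so the
    series factors as E^k C^e ([tree_series_pair_tree]). E is affine in H1 and C is affine in s
    ([H1_catalan], [sqrt14_catalan]), so weight 2k + e is attained ([has_degree_catalan]).

    For the lower bound ([wdeg_lower_bound]), an expression of smaller weight survives clearing
    denominators and reduction modulo a large prime p, since all the series have integer
    coefficients. Modulo p, A' is a rational multiple of A ([cbin_poly_logderiv]), hence so are H1
    and H2 ([H1x_cbin], [H2x_cbin]), and total degree in H1, H2 becomes degree in A. The term A^k
    s^e coming from E^k C^e cannot then be cancelled ([no_relation]), provided A satisfies no
    relation of degree below p - 1 ([transcendental_below]). Comparing a minimal relation with its
    Frobenius transform would make a power of a, up to (p-1)-th powers, a (p-1)-th power;
    [pth_power_relation] forbids this for squarefree a, and [cbin_poly_coprime_deriv] supplies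
    squarefreeness.

    At t = 1/4 the partial sums of C and E telescope and Wallis' integrals give their limits
    ([cvg_series_catalan], [cvg_series_catalan_sqr]). Coefficients being nonnegative, values
    multiply ([quarter_valueM]), and the result is 2^e (16/pi - 4)^k. *)

(** * Algebraic degree of a root of A = a A^p *)

(* An identity between power series is tested on truncated polynomials,        *)
(* modulo X^N for all N.                                                       *)
Definition eqXn (F : fieldType) N (f g : {poly F}) := 'X^N %| f - g.

Section EqXn.
Variables (F : fieldType) (N : nat).
Implicit Types f g h : {poly F}.

Lemma eqXn_refl f : eqXn N f f. Proof. by rewrite /eqXn subrr dvdp0. Qed.

Lemma eq_eqXn f g : f = g -> eqXn N f g.
Proof. by move=> ->; apply: eqXn_refl. Qed.

Lemma eqXn_sym f g : eqXn N f g -> eqXn N g f.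
Proof. by rewrite /eqXn -opprB dvdpNr. Qed.

Lemma eqXn_trans f g h : eqXn N f g -> eqXn N g h -> eqXn N f h.
Proof. by rewrite /eqXn => fg gh; rewrite -(subrKA g) dvdp_add. Qed.

Lemma eqXnD f f' g g' : eqXn N f f' -> eqXn N g g' -> eqXn N (f + g) (f' + g').
Proof. by rewrite /eqXn => ff gg; rewrite opprD addrACA dvdp_add. Qed.

Lemma eqXnB f f' g g' : eqXn N f f' -> eqXn N g g' -> eqXn N (f - g) (f' - g').
Proof. rewrite /eqXn => ff gg; have -> : f - g - (f' - g') = (f - f') - (g - g') by ring.
by rewrite dvdp_sub.
Qed.

Lemma eqXnM f f' g g' : eqXn N f f' -> eqXn N g g' -> eqXn N (f * g) (f' * g').
Proof.
rewrite /eqXn => ff gg; have -> : f * g - f' * g' = (f - f') * g + f' * (g - g').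
  by ring.
by apply: dvdp_add; [apply: dvdp_mulr | apply: dvdp_mull].
Qed.

Lemma eqXnMl h f g : eqXn N f g -> eqXn N (h * f) (h * g).
Proof. by move=> fg; apply: eqXnM => //; apply: eqXn_refl. Qed.

Lemma eqXnX f g k : eqXn N f g -> eqXn N (f ^+ k) (g ^+ k).
Proof.
by move=> fg; elim: k => [|k IHk]; [apply: eqXn_refl | rewrite !exprS; apply: eqXnM].
Qed.

Lemma eqXn_sum (I : Type) (r : seq I) (f g : I -> {poly F}) :
  (forall i, eqXn N (f i) (g i)) ->
  eqXn N (\sum_(i <- r) f i) (\sum_(i <- r) g i).
Proof.
move=> fg; apply: (big_ind2 (eqXn N)) => // [|f1 f2 g1 g2]; first exact: eqXn_refl.
exact: eqXnD.
Qed.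

Lemma eqXn_coef f g : (forall i, (i < N)%N -> f`_i = g`_i) -> eqXn N f g.
Proof.
move=> fg; apply/dvdpP; exists (drop_poly N (f - g)).
rewrite -[LHS](poly_take_drop N) [X in X + _](_ : _ = 0) ?add0r //.
apply/polyP => i; rewrite coef_take_poly coef0; case: ifP => // /fg.
by rewrite coefB => ->; rewrite subrr.
Qed.

Lemma eqXn_comp f g : eqXn N f g -> eqXn N (f \Po 'X^2) (g \Po 'X^2).
Proof.
rewrite /eqXn => /(dvdp_comp_poly 'X^2); rewrite comp_polyB comp_Xn_poly.
by apply: dvdp_trans; rewrite -exprM dvdp_exp2l // leq_pmull.
Qed.

End EqXn.

Lemma dvdpXn_eq0 (F : fieldType) (c : {poly F}) :
  (forall N, 'X^N %| c) -> c = 0.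
Proof.
move=> /(_ (size c)) dvd_c; apply/eqP; apply: contraTT dvd_c => c_neq0.
by apply/negP => /(dvdp_leq c_neq0); rewrite size_polyXn ltnn.
Qed.

Section RootOfPoly.
Variables (F : fieldType) (p : nat) (charFp : p \in [pchar F]).
Variables (a : {poly F}) (A : nat -> {poly F}).
Hypothesis size_a : (1 < size a)%N.
Hypothesis a_sqf : coprimep a a^`().
Hypothesis A_unit : forall N, coprimep 'X^N (A N).
Hypothesis A_frob : forall N, 'X^N %| A N - a * A N ^+ p.

(** Logarithmic derivatives: as p - 1 = -1 in [F], equality would give d'/d = c'/c - m a'/a. For
    coprime c and d, squarefreeness makes a divide c d, while c divides d^(p-1) and so is a unit.
    Then a divides d and a^(p-1) divides a^m, against degrees. *)
Lemma pth_power_relation (m : nat) (c d : {poly F}) : (0 < m < p.-1)%N ->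
  c != 0 -> c ^+ p.-1 * a ^+ m <> d ^+ p.-1.
Proof.
move=> /andP[m_gt0 lt_mp] c_neq0.
wlog cop_cd: c d c_neq0 / coprimep c d => [wlog_cd eq_cd|].
  set g := gcdp c d; have g_neq0 : g != 0 by rewrite gcdp_eq0 negb_and c_neq0.
  have c_def : c = c %/ g * g by rewrite divpK // dvdp_gcdl.
  have d_def : d = d %/ g * g by rewrite divpK // dvdp_gcdr.
  apply: (wlog_cd (c %/ g) (d %/ g)).
  - by apply: contraNneq c_neq0 => cg0; rewrite c_def cg0 mul0r.
  - by rewrite coprimep_div_gcd // c_neq0.
  - move: eq_cd; rewrite {1}c_def {1}d_def !exprMn mulrAC.
    by apply: mulIf; rewrite expf_neq0.
have p_gt2 : (2 < p)%N by lia.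
have p_eq0 : p%:R = 0 :> F by apply/eqP; rewrite -(dvdn_pcharf charFp).
have p1E : (p.-1)%:R = -1 :> F.
  by apply/eqP; rewrite -addr_eq0 natr1 prednK ?p_eq0 //; lia.
move=> eq_cd.
have a_neq0 : a != 0 by rewrite -size_poly_gt0; lia.
have d_neq0 : d != 0.
  apply/eqP => d0; move: eq_cd; rewrite d0 expr0n gtn_eqF; last lia.
  by move/eqP; rewrite mulf_eq0 !expf_eq0 (negPf c_neq0) (negPf a_neq0) !andbF.
have m_neq0 : m%:R != 0 :> F.
  by rewrite -(dvdn_pcharf charFp); apply/negP => /dvdn_leq; lia.
have deriv_eq : c * d^`() * a = d * (c^`() * a - m%:R *: (c * a^`())).
  have [q pE] : exists q, p = q.+2 by exists p.-2; lia.
  have [k mE] : exists k, m = k.+1 by exists m.-1; lia.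
  have q1E : (q.+1)%:R = -1 :> {poly F}.
    by rewrite -(rmorph_nat polyC) -[X in X%:R]/(q.+2.-1) -pE p1E rmorphN1.
  have /(congr1 (fun r => r^`())) := eq_cd; move: eq_cd.
  rewrite pE mE !derivCE -[_ * c ^+ _ *+ _]mulr_natl -[_ * d ^+ _ *+ _]mulr_natl
    -[_ * a ^+ _ *+ _]mulr_natl q1E.
  rewrite -mul_polyC (rmorph_nat polyC) /= !exprS.
  move: (c^`()) (a^`()) (d^`()) (k.+1)%:R => c' a' d' mP.
  have dq_neq0 := expf_neq0 q d_neq0; move: dq_neq0.
  move: (c ^+ q) (a ^+ k) (d ^+ q) => cq ak dq dq_neq0 eq_cd eqD.
  apply: (mulfI dq_neq0).
  have E1 : c * a * (-1 * (c' * cq) * (a * ak) + c * cq * (mP * (a' * ak)))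
     = (c * cq * (a * ak)) * (mP * (c * a') - c' * a) by ring.
  move: E1; rewrite eqD eq_cd => eqE.
  have -> : dq * (c * d' * a) = - (c * a * (-1 * (d' * dq))) by ring.
  by rewrite eqE; ring.
have a_dvd_cd : a %| c * d.
  have : a %| d * (m%:R *: (c * a^`())).
    have -> : d * (m%:R *: (c * a^`())) = (d * c^`() - c * d^`()) * a.
      by rewrite mulrBl deriv_eq mulrBr; ring.
    by rewrite dvdp_mull.
  by rewrite -scalerAr dvdpZr // mulrA [d * c]mulrC Gauss_dvdpl.
have c_unit : c %| 1.
  have : c %| d ^+ p.-1 by rewrite -eq_cd dvdp_mulr // dvdp_exp //; lia.
  by rewrite -[d ^+ _]mulr1 Gauss_dvdpr // coprimep_expr.
have a_dvd_d : a %| d.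
  have := dvdp_mul c_unit (dvdpp d); rewrite mul1r.
  exact: dvdp_trans.
have ap_dvd : a ^+ p.-1 %| a ^+ m.
  have -> : a ^+ m = 1 * a ^+ m by rewrite mul1r.
  apply: dvdp_trans (_ : c ^+ p.-1 * a ^+ m %| _).
    by rewrite eq_cd dvdp_exp2r.
  by apply: dvdp_mul => //; rewrite -[X in _ %| X](expr1n _ p.-1) dvdp_exp2r.
have := leq_sub2r 1 (dvdp_leq (expf_neq0 m a_neq0) ap_dvd).
rewrite !subn1 !size_exp leq_mul2l leqNgt lt_mp orbF -subn1 subn_eq0.
by rewrite leqNgt size_a.
Qed.

(** The bound is sharp: A = a A^p with A a unit gives the relation a A^(p-1) = 1 of degree p - 1. *)
Lemma transcendental_below (f : {poly {poly F}}) : (size f < p)%N ->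
  (forall N, 'X^N %| f.[A N]) -> f = 0.
Proof.
have p_gt0 : (0 < p)%N by apply/prime_gt0/(pcharf_prime charFp).
have charPp : p \in [pchar {poly F}].
  by rewrite pchar_poly.
have [n] := ubnP (size f); elim: n f => // n IHn f; rewrite ltnS => le_fn lt_fp fA.
apply/eqP; apply/negPn/negP => f_neq0.
have [m size_f] : exists m, size f = m.+1.
  by exists (size f).-1; rewrite prednK // size_poly_gt0.
have m_gt0 : (0 < m)%N.
  case: m size_f => // size_f; case/negP: f_neq0.
  have f_const := size1_polyC (eq_leq size_f); rewrite f_const.
  suff -> : f`_0 = 0 by rewrite polyC0.
  by apply: dvdpXn_eq0 => N; have := fA N; rewrite {1}f_const hornerC.
(* A relation without constant term can be divided by A, a unit modulo X^N, which lowers its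
   degree. *)
have f0_neq0 : f`_0 != 0.
  apply/eqP => f00; have [g fE] : exists g, f = g * 'X.
    have /factor_theorem[g] : root f 0 by rewrite /root horner_coef0 f00.
    by rewrite subr0; exists g.
  have g_neq0 : g != 0 by apply: contraNneq f_neq0 => g0; rewrite fE g0 mul0r.
  have size_g : size f = (size g).+1 by rewrite fE size_mulX.
  have g0 : g = 0.
    apply: IHn; [by lia..|] => N; have := fA N.
    by rewrite fE hornerM hornerX Gauss_dvdpl.
  by case/negP: g_neq0; rewrite g0.
(* [a ^+ m] times the p-th power of the relation [f], rewritten by A^p = A/a *)
pose h : {poly {poly F}} := \poly_(j < m.+1) (f`_j ^+ p * a ^+ (m - j)).
have hA N : 'X^N %| h.[A N].
  have fAE : f.[A N] = \sum_(j < m.+1) f`_j * A N ^+ j.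
    by rewrite horner_coef size_f.
  rewrite horner_poly.
  have : 'X^N %| a ^+ m * f.[A N] ^+ p by rewrite dvdp_mull // dvdp_exp.
  rewrite -(pFrobenius_autE charPp) fAE rmorph_sum mulr_sumr /=.
  rewrite -[X in _ -> _ %| X](subrK (\sum_(j < m.+1)
    a ^+ m * pFrobenius_aut charPp (f`_j * A N ^+ j))).
  move=> sumA; rewrite dvdp_add // -sumrB; apply: (big_ind (fun q => 'X^N %| q)).
  - exact: dvdp0.
  - exact: dvdp_add.
  move=> j _; rewrite pFrobenius_autE exprMn.
  have -> : a ^+ m = a ^+ (m - j) * a ^+ j by rewrite -exprD subnK // -ltnS.
  have -> : f`_j ^+ p * a ^+ (m - j) * A N ^+ j
     - a ^+ (m - j) * a ^+ j * (f`_j ^+ p * (A N ^+ j) ^+ p)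
     = f`_j ^+ p * a ^+ (m - j) * (A N ^+ j - (a * A N ^+ p) ^+ j).
    by rewrite exprMn -!exprM [(j * p)%N]mulnC; ring.
  by rewrite dvdp_mull // subrXX dvdp_mulr.
(* The terms of degree m cancel, so g = 0 by induction; its constant coefficient is the equation
   excluded by [pth_power_relation]. *)
pose g := lead_coef f *: h - (lead_coef f ^+ p) *: f.
have g0 : g = 0.
  have le_gm : (size g <= m)%N.
    apply/leq_sizeP => j; rewrite leq_eqVlt => /predU1P[<-|lt_mj].
      by rewrite coefB !coefZ coef_poly ltnSn subnn expr0 mulr1 /lead_coef size_f /=; ring.
    by rewrite coefB !coefZ coef_poly ltnS leqNgt lt_mj nth_default ?size_f // !mulr0 subr0.
  apply: IHn; [by lia..|] => N.
  by rewrite hornerD hornerN !hornerZ dvdp_sub ?dvdp_mull.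
have := congr1 (fun q : {poly {poly F}} => q`_0) g0.
rewrite coef0 coefB !coefZ coef_poly /= subn0 => /eqP; rewrite subr_eq0.
set d := lead_coef f => /eqP eq_d.
have d_neq0 : d != 0 by rewrite lead_coef_eq0.
apply: (@pth_power_relation m f`_0 d) => //; first by lia.
apply: (@mulfI _ d) => //; rewrite -exprS prednK //.
apply: (@mulIf _ f`_0) => //; rewrite -eq_d -(prednK p_gt0) exprS; ring.
Qed.

End RootOfPoly.

(** * The truncated series of squares of central binomials modulo p *)

Definition cbin (n : nat) : nat := 'C(n.*2, n).

Lemma cbinS n : (n.+1 * cbin n.+1 = 2 * n.*2.+1 * cbin n)%N.
Proof.
have diag1 := mul_bin_diag n.*2.+2 n; have down := mul_bin_down n.*2.+1 n.
have -> : cbin n.+1 = 'C(n.*2.+2, n.+1) by rewrite /cbin doubleS.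
move: down; have -> : (n.*2.+1 - n = n.+1)%N by lia.
rewrite /cbin -diag1 succnK -doubleS -[n.+1.*2]mul2n -!mulnA.
by move=> ->; rewrite [(2 * n.+1)%N]mul2n doubleS.
Qed.

Lemma bin2_prime (p n : nat) : prime p -> (n < p)%N ->
  (p %| cbin n)%N = (p <= n.*2)%N.
Proof.
move=> p_pr lt_np.
have dvd_fact m : (p %| m`!)%N = (p <= m)%N.
  elim: m => [|m IHm]; first by rewrite dvdn1 leqn0; case: p p_pr {lt_np} => [|[]].
  rewrite factS Euclid_dvdM // IHm [RHS]leq_eqVlt ltnS.
  case: leqP => [|lt_mp]; rewrite ?orbT // !orbF.
  apply/idP/eqP => [/dvdn_leq|->//]; lia.
rewrite -dvd_fact -(@bin_fact n.*2 n); last lia.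
rewrite !Euclid_dvdM // !dvd_fact.
have -> : (n.*2 - n = n)%N by rewrite -addnn addnK.
by rewrite leqNgt lt_np /= !orbF.
Qed.

Section Hasse.
Variables (F : fieldType) (p : nat) (charFp : p \in [pchar F]).
Hypothesis p_gt3 : (3 < p)%N.

Let p_pr : prime p := pcharf_prime charFp.
Let natF_eq0 n : (n%:R == 0 :> F) = (p %| n)%N.
Proof. by rewrite (dvdn_pcharf charFp). Qed.

Lemma coef_expD1 (N n : nat) : ((1 + 'X) ^+ N : {poly F})`_n = 'C(N, n)%:R.
Proof.
rewrite exprDn; under eq_bigr => i _ do rewrite expr1n mul1r.
rewrite coef_sum; case: (ltnP n N.+1) => [lt_nN | lt_Nn].
  rewrite (bigD1 (Ordinal lt_nN)) //= coefMn coefXn eqxx big1 ?addr0 // => i.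
  by rewrite -val_eqE /= coefMn coefXn eq_sym => /negPf->; rewrite mul0rn.
rewrite bin_small // big1 // => i _; rewrite coefMn coefXn gtn_eqF ?mul0rn //.
exact: leq_trans (ltn_ord i) lt_Nn.
Qed.

(** The coefficients lie in the prime field, which Frobenius fixes. *)
Lemma nat_poly_frob (f : {poly F}) (c : nat -> nat) :
  (forall i, f`_i = (c i)%:R) -> f ^+ p = f \Po 'X^p.
Proof.
move=> fE; have charPp : p \in [pchar {poly F}] by rewrite pchar_poly.
rewrite -(pFrobenius_autE charPp) comp_polyE -[X in pFrobenius_aut _ X]coefK.
rewrite poly_def rmorph_sum; apply: eq_bigr => i _ /=.
rewrite -!mul_polyC rmorphM fE /= !pFrobenius_autE -polyC_exp.
by rewrite -(pFrobenius_autE charFp) pFrobenius_aut_nat -!exprM mulnC.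
Qed.

(** For n = dp + r, compare coefficients of X^n in (1 + X)^(2n) = (1 + X)^(2r) ((1 + X)^(2d))(X^p).
    Any other exponent congruent to r is at least r + p > 2r, so a single product contributes. *)
Lemma cbin_lucas n :
  (cbin n)%:R = (cbin (n %% p))%:R * (cbin (n %/ p))%:R :> F.
Proof.
have p_gt0 : (0 < p)%N by lia.
set r := (n %% p)%N; set d := (n %/ p)%N.
have lt_rp : (r < p)%N by rewrite ltn_mod.
have nE : n = (d * p + r)%N by rewrite /d /r -divn_eq.
have frob : (1 + 'X : {poly F}) ^+ n.*2
          = (1 + 'X) ^+ r.*2 * ((1 + 'X) ^+ d.*2 \Po 'X^p).
  rewrite -(nat_poly_frob (coef_expD1 d.*2)) -exprM -exprD.
  by congr (_ ^+ _); rewrite {1}nE doubleD addnC -!muln2 mulnAC.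
rewrite /cbin -!coef_expD1 frob coefM.
have lt_rn : (r < n.+1)%N by rewrite ltnS leq_mod.
rewrite (bigD1 (Ordinal lt_rn)) //= coef_comp_poly_Xn //.
have -> : (n - r = d * p)%N by rewrite {1}nE addnK.
rewrite dvdn_mull // mulnK // big1 ?addr0 // => i; rewrite -val_eqE /= => ne_ir.
rewrite coef_comp_poly_Xn //; case: ifP => [dvd_pi|]; last by rewrite mulr0.
rewrite [X in X * _]coef_expD1 bin_small ?mul0r //.
case/dvdnP: dvd_pi => e eE; have lt_in := ltn_ord i.
move: nE lt_rp ne_ir lt_in eE; clearbody r d; move: (i : nat) => j.
move=> nE lt_rp /eqP ne_jr lt_jn eE.
have [lt_ed|lt_de|eq_ed] := ltngtP e d; last by subst e; lia.
  by have := leq_mul lt_ed (leqnn p); rewrite mulSn; lia.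
by have := leq_mul lt_de (leqnn p); rewrite mulSn; lia.
Qed.

Definition cbin_poly N : {poly F} := \poly_(i < N) ((cbin i) ^ 2)%:R.
Local Notation A := cbin_poly.
Local Notation a := (cbin_poly p).

Lemma cbin_poly_frob N : eqXn N (A N) (a * A N ^+ p).
Proof.
have p_gt0 : (0 < p)%N by lia.
pose c i := if (i < N)%N then (cbin i ^ 2)%N else 0%N.
have AE i : (A N)`_i = (c i)%:R by rewrite coef_poly /c; case: ifP.
rewrite (nat_poly_frob AE).
apply: eqXn_coef => i lt_iN; have lt_ii : (i %% p < i.+1)%N by rewrite ltnS leq_mod.
rewrite [RHS]coefM (bigD1 (Ordinal lt_ii)) //= big1 => [|j].
  have sub_mod : (i - i %% p = i %/ p * p)%N by rewrite {1}(divn_eq i p) addnK.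
  rewrite sub_mod coef_comp_poly_Xn // dvdn_mull // mulnK // !coef_poly.
  rewrite ltn_mod p_gt0 lt_iN (leq_ltn_trans (leq_div _ _) lt_iN).
  by rewrite addr0 !natrX cbin_lucas exprMn.
rewrite -val_eqE /= coef_comp_poly_Xn // coef_poly => ne_j.
case: ifP => [lt_jp|]; last by rewrite mul0r.
case: ifP => [/dvdnP[e eE]|]; last by rewrite mulr0.
case/eqP: ne_j; have lt_ji := ltn_ord j.
have iE : i = (e * p + j)%N by lia.
by rewrite [RHS](congr1 (modn^~ p) iE) modnMDl modn_small.
Qed.

Lemma cbin_vanish n : (n < p)%N -> (p <= n.*2)%N -> (cbin n)%:R = 0 :> F.
Proof. by move=> lt_np le_pn; apply/eqP; rewrite natF_eq0 bin2_prime. Qed.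

(** Truncating at X^p does not break the recurrence: at i = p - 1 both sides vanish, because p
    divides binom(2i, i). Hence the polynomial a is an exact solution of the hypergeometric
    equation. *)
Lemma coef_cbin_polyS i :
  (i.+1)%:R ^+ 2 * a`_i.+1 = 4%:R * (i.*2.+1)%:R ^+ 2 * a`_i.
Proof.
have recF : (i.+1)%:R ^+ 2 * ((cbin i.+1) ^ 2)%:R
    = 4%:R * (i.*2.+1)%:R ^+ 2 * ((cbin i) ^ 2)%:R :> F.
  by rewrite -[4%N]/(2 ^ 2)%N !natrX -!exprMn -!natrM cbinS.
rewrite !coef_poly; have [lt_ip|] := ltnP i.+1 p; first by rewrite ltnW.
rewrite leq_eqVlt mulr0 => /predU1P[pE|lt_pi]; last first.
  by rewrite ltnNge -ltnS lt_pi mulr0.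
by rewrite pE ltnSn natrX cbin_vanish ?expr0n ?mulr0 //; lia.
Qed.

Lemma coef_Xderiv (f : {poly F}) i : ('X * f^`())`_i = i%:R * f`_i.
Proof. by rewrite coefXM; case: i => [|i]; rewrite ?mul0r // coef_deriv mulr_natl. Qed.

(* The k-th derivative of the hypergeometric equation x(1-16x)a'' + (1-32x)a' = 4a. *)
Lemma cbin_poly_ode k : 'X * (1 - 16%:R * 'X) * a^`(k.+2)
  + k.+1%:R * ((1 - 32%:R * 'X) * a^`(k.+1))
  = 4%:R * k.*2.+1%:R ^+ 2 * a^`(k).
Proof.
elim: k => [|k IHk].
  apply: (mulfI (negbT (polyX_eq0 F))).
  (* With theta = x d/dx, the recurrence reads theta^2 a = 4x (2 theta + 1)^2 a. *)
  have theta2 : 'X * ('X * a^`())^`()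
      = 'X * (4%:R * (4%:R * ('X * ('X * a^`())^`()) + 4%:R * ('X * a^`()) + a)).
    apply/polyP => i; rewrite coef_Xderiv coef_Xderiv [RHS]coefXM.
    case: i => [|i] /=; first by rewrite !mul0r.
    rewrite -!(rmorph_nat polyC) coefCM !coefD !coefCM !coef_Xderiv.
    rewrite mulrA -expr2 coef_cbin_polyS -[i.*2.+1]addn1 -[i.*2]mul2n natrD natrM; ring.
  move: theta2; rewrite !derivCE -derivn1 -derivnS derivn0.
  move: (a^`(1)) (a^`(2)) a => a1 a2 a0 E.
  move/eqP: E; rewrite -subr_eq0 => /eqP E.
  by apply/eqP; rewrite -subr_eq0 -E -[0.*2.+1]/1%N; apply/eqP; ring.
have derivMnat n (f : {poly F}) : (n%:R * f)^`() = n%:R * f^`().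
  by rewrite !mulr_natl derivMn.
have deriv_nat n : (n%:R : {poly F})^`() = 0.
  by rewrite -polyC_natr derivC.
have := congr1 (fun q => q^`()) IHk.
rewrite derivD derivM derivM derivX derivB derivMnat derivX (deriv_nat 1%N) sub0r.
rewrite derivMnat derivM derivB derivMnat derivX (deriv_nat 1%N) sub0r.
rewrite -[4%:R * _]/(4%:R * k.*2.+1%:R ^+ 2) -natrX -natrM derivMnat -!derivnS.
move: (a^`(k.+1)) (a^`(k.+2)) (a^`(k.+3)) => a1 a2 a3 E.
move/eqP: E; rewrite -subr_eq0 => /eqP E; apply/eqP; rewrite -subr_eq0 -E; apply/eqP.
rewrite -![k.+2]addn1 -![k.+1]addn1 -![_.*2.+1]addn1 -!muln2 natrM natrX !natrD !natrM !natrD.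
ring.
Qed.

Let q := p./2.
Let pE : p = q.*2.+1.
Proof.
have := odd_double_half p; rewrite (_ : odd p) ?add1n //.
by apply: contraTT p_gt3; rewrite -dvdn2 dvdn_prime2 // => /eqP<-.
Qed.

Lemma coef_cbin_poly_half : a`_q != 0.
Proof.
rewrite coef_poly ifT; last lia.
by rewrite natrX expf_neq0 // natF_eq0 bin2_prime //; lia.
Qed.

Lemma size_cbin_poly : size a = q.+1.
Proof.
apply/eqP; rewrite eqn_leq; apply/andP; split; last first.
  by rewrite ltnNge; apply: contra coef_cbin_poly_half => /leq_sizeP->.
apply/leq_sizeP => j lt_qj; rewrite coef_poly; case: ifP => // lt_jp.
by rewrite natrX cbin_vanish ?expr0n //; lia.
Qed.

Lemma derivn_half_cbin_poly : a^`(q) = (a`_q *+ q`!)%:P.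
Proof.
apply/polyP => i; rewrite coef_derivn coefC; case: i => [|i] /=.
  by rewrite addn0 ffactnn.
by rewrite nth_default ?mul0rn // size_cbin_poly addnS ltnS leq_addr.
Qed.

Lemma derivn_half_cbin_poly_neq0 : a`_q *+ q`! != 0.
Proof.
rewrite -mulr_natr mulf_neq0 ?coef_cbin_poly_half // natF_eq0.
have : (q < p)%N by lia.
elim: q => [|n IHn] lt_np; first by rewrite dvdn1; lia.
rewrite factS Euclid_dvdM // negb_or IHn ?andbT; last lia.
by apply/negP => /dvdn_leq; lia.
Qed.

Lemma cbin_poly_coprime_sing : coprimep a ('X * (1 - 16%:R * 'X)).
Proof.
have n16 : 16%:R != 0 :> F.
  rewrite natF_eq0 -[16%N]/(2 ^ 4)%N Euclid_dvdX //.
  by apply/negP => /andP[/dvdn_leq]; lia.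
rewrite coprimepMr; apply/andP; split.
  rewrite -['X]subr0 -polyC0 coprimep_XsubC /root horner_coef0 coef_poly.
  by rewrite ifT ?oner_eq0; last lia.
have -> : 1 - 16%:R * 'X = (- 16%:R) *: ('X - (16%:R^-1)%:P) :> {poly F}.
  by rewrite -mul_polyC mulrBr -polyCM mulNr mulfV // !polyCN polyC_natr polyC1; ring.
rewrite coprimepZr ?oppr_eq0 // coprimep_XsubC; apply/negP => /eqP a_tau.
set tau := 16%:R^-1 in a_tau.
(* At the singular point tau the equation reads -(k+1)a^(k+1) = 4(2k+1)^2 a^(k). *)
have deriv_tau k : (k <= q)%N -> (a^`(k)).[tau] = 0.
  elim: k => [|k IHk] le_kq; first by rewrite derivn0.
  have /(congr1 (fun f => f.[tau])) := cbin_poly_ode k.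
  have hnat n : (n%:R : {poly F}).[tau] = n%:R by rewrite -polyC_natr hornerC.
  rewrite -natrX -natrM !(hornerD, hornerM, hornerN, hnat, hornerX) (hnat 1%N).
  rewrite IHk ?mulr0; last lia.
  rewrite mulfV // subrr mulr0 mul0r add0r => /eqP; rewrite !mulf_eq0.
  have -> : (k.+1%:R == 0 :> F) = false by rewrite natF_eq0; apply/negP => /dvdn_leq; lia.
  have -> : (1 - 32%:R * tau == 0) = false.
    have -> : 1 - 32%:R * tau = - (16%:R * tau).
      by rewrite -[32%N]/(16 * 2)%N natrM mulrAC mulfV //; ring.
    by rewrite mulfV // oppr_eq0 oner_eq0.
  by move/eqP.
have := deriv_tau q (leqnn q); rewrite derivn_half_cbin_poly hornerC => /eqP.
by rewrite (negPf derivn_half_cbin_poly_neq0).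
Qed.

(** Away from the singular points 0 and 1/16, which are not roots of a, the differential equation
    expresses a^(k+2) through a^(k) and a^(k+1). So the gcd of a and a' divides all derivatives,
    including the q-th, a nonzero constant. *)
Lemma cbin_poly_coprime_deriv : coprimep a a^`().
Proof.
set g := gcdp a a^`().
have g_dvd k : (g %| a^`(k)) && (g %| a^`(k.+1)).
  elim: k => [|k /andP[IHk IHk1]]; first by rewrite derivn1 derivn0 dvdp_gcdl dvdp_gcdr.
  rewrite IHk1 /=.
  have cop_g : coprimep g ('X * (1 - 16%:R * 'X)).
    exact: coprimep_dvdr (dvdp_gcdl _ _) cbin_poly_coprime_sing.
  rewrite -(Gauss_dvdpr _ cop_g).
  rewrite -[_ * a^`(k.+2)](addrK (k.+1%:R * ((1 - 32%:R * 'X) * a^`(k.+1)))).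
  by rewrite cbin_poly_ode dvdp_sub // ?dvdp_mull // !dvdp_mull.
have /andP[+ _] := g_dvd q; rewrite derivn_half_cbin_poly => g_const.
rewrite /coprimep -/g; have c_neq0 : (a`_q *+ q`!)%:P != 0.
  by rewrite polyC_eq0 derivn_half_cbin_poly_neq0.
have := dvdp_leq c_neq0 g_const; rewrite size_polyC derivn_half_cbin_poly_neq0.
have : (0 < size g)%N by rewrite size_poly_gt0; apply: dvdpN0 g_const c_neq0.
lia.
Qed.
End Hasse.

(** * Reduction of a relation of low weight to a polynomial killing A *)

Section NoRelation.
Variables (F : fieldType) (A : nat -> {poly F}) (n : nat).
Hypothesis A_transc : forall f : {poly {poly F}}, (size f < n)%N ->
  (forall N, 'X^N %| f.[A N]) -> f = 0.
Variables (g1 g2 b : {poly F}) (H1 H2 s : nat -> {poly F}).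
Hypothesis g1_neq0 : g1 != 0.
Hypothesis H1A : forall N, eqXn N (b * H1 N) (g1 * A N).
Hypothesis H2A : forall N, eqXn N (b * H2 N) (g2 * A N).
Hypothesis s_sqr : forall N, eqXn N (s N ^+ 2) (1 - 4%:R * 'X).
Hypothesis F4 : 4%:R != 0 :> F.

(** The leading coefficients in A would satisfy l0^2 = (1 - 4t) l1^2, whose two sides have degrees
    in t of different parity. *)
Lemma sqr_norm_eq0 (f0 f1 : {poly {poly F}}) :
  f0 ^+ 2 - (1 - 4%:R * 'X)%:P * f1 ^+ 2 = 0 -> f0 = 0 /\ f1 = 0.
Proof.
move/eqP; rewrite subr_eq0 => /eqP f01.
suff f10 : f1 = 0.
  by split=> //; apply/eqP; move/eqP: f01; rewrite f10 expr0n mulr0 expf_eq0.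
apply/eqP/negPn/negP => f1_neq0.
have := congr1 lead_coef f01; rewrite lead_coef_exp lead_coefM lead_coefC lead_coef_exp.
set l0 := lead_coef f0; set l1 := lead_coef f1 => eq_l.
have l1_neq0 : l1 != 0 by rewrite lead_coef_eq0.
have size_lin : size (1 - 4%:R * 'X : {poly F}) = 2%N.
  rewrite -polyC_natr mul_polyC addrC -scaleNr size_addl size_scale ?oppr_eq0 ?size_polyX //.
  by rewrite size_poly1.
have := congr1 (fun f : {poly F} => (size f).-1) eq_l.
have lin_neq0 : (1 - 4%:R * 'X : {poly F}) != 0 by rewrite -size_poly_gt0 size_lin.
rewrite [in RHS]size_mul ?expf_neq0 // size_lin size_exp /=.
have : (0 < size (l1 ^+ 2))%N by rewrite size_poly_gt0 expf_neq0.
by have := size_exp l1 2; move: (size (l1 ^+ 2)) (size l0).-1 (size l1).-1; lia.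
Qed.

(** The right side contributes A^k s^e, of weight 2k + e, out of reach of the left side. Multiplying
    f0(A) + s f1(A) by its conjugate removes s but doubles the degree in A, whence the bound on
    k. *)
Lemma no_relation (I : Type) (r : seq I) (i0 i1 i2 : I -> nat)
    (c : I -> {poly F}) (d : {poly F}) (k : nat) (e : bool) :
    (k.*2.+1 < n)%N -> d != 0 ->
    (forall i, c i != 0 -> (2 * (i0 i + i1 i) + i2 i < 2 * k + e)%N) ->
  ~ (forall N, eqXn N (\sum_(i <- r) c i * H1 N ^+ i0 i * H2 N ^+ i1 i * s N ^+ i2 i)
      (d * (H1 N - 1) ^+ k * (1 - s N) ^+ e)).
Proof.
move=> lt_kn d_neq0 deg_c rel.
pose lin := 1 - 4%:R * 'X : {poly F}.
pose term i : {poly {poly F}} := (c i * b ^+ (k - (i0 i + i1 i)) * g1 ^+ i0 i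
  * g2 ^+ i1 i * lin ^+ (i2 i)./2) *: 'X^(i0 i + i1 i).
pose G : {poly {poly F}} := d *: (g1%:P * 'X - b%:P) ^+ k.
(* After multiplication by [b ^+ k], the relation reads f0(A) + s f1(A) = 0. *)
pose f0 := \sum_(i <- r) (if odd (i2 i) then 0 else term i) - G.
pose f1 := \sum_(i <- r) (if odd (i2 i) then term i else 0) + (if e then G else 0).
have cle i : c i != 0 -> (i0 i + i1 i <= k)%N.
  by move=> /deg_c; case: e {deg_c rel f1} => /=; lia.
have linP_neq0 : g1%:P * 'X - b%:P != 0 :> {poly {poly F}}.
  rewrite -polyCN -size_poly_gt0 size_MXaddC polyC_eq0 (negPf g1_neq0) /=.
  by rewrite size_polyC g1_neq0.
have lin_size : (size (g1%:P * 'X - b%:P : {poly {poly F}})).-1 = 1%N.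
  by rewrite -polyCN size_MXaddC polyC_eq0 (negPf g1_neq0) /= size_polyC g1_neq0.
have size_G : size G = k.+1.
  rewrite size_scale // -[LHS]prednK ?size_poly_gt0 ?expf_neq0 //.
  by rewrite size_exp lin_size mul1n.
have G_k : G`_k = d * g1 ^+ k.
  rewrite coefZ; congr (_ * _).
  rewrite -[X in _`_X]mul1n -lin_size -size_exp -lead_coefE lead_coef_exp.
  by rewrite lead_coefE lin_size coefB coefMX !coefC subr0.
have size_term i : (size (term i) <= k.+1)%N.
  have [ci0|/cle le_k] := eqVneq (c i) 0; first by rewrite /term ci0 !mul0r scale0r size_poly0.
  apply: leq_trans (size_scale_leq _ _) _; rewrite size_polyXn; lia.
have size_f0 : (size f0 <= k.+1)%N.
  rewrite (leq_trans (size_polyD _ _)) // size_polyN geq_max size_G leqnn andbT.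
  apply: (big_ind (fun f : {poly {poly F}} => (size f <= k.+1)%N)).
  - by rewrite size_poly0.
  - by move=> f g lef leg; rewrite (leq_trans (size_polyD _ _)) // geq_max lef.
  - by move=> i _; case: ifP => _; rewrite ?size_poly0.
have size_f1 : (size f1 <= k.+1)%N.
  rewrite (leq_trans (size_polyD _ _)) // geq_max; apply/andP; split; last first.
    by case: (e); rewrite ?size_poly0 ?size_G.
  apply: (big_ind (fun f : {poly {poly F}} => (size f <= k.+1)%N)).
  - by rewrite size_poly0.
  - by move=> f g lef leg; rewrite (leq_trans (size_polyD _ _)) // geq_max lef.
  - by move=> i _; case: ifP => _; rewrite ?size_poly0.
have fA N : eqXn N (f0.[A N] + s N * f1.[A N]) 0.
  have := eqXnMl (b ^+ k) (rel N); set rhs := b ^+ k * (_ * _) => rel_b.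
  have GA : eqXn N (b ^+ k * (d * (H1 N - 1) ^+ k)) G.[A N].
    rewrite hornerZ horner_exp hornerD hornerN hornerM !hornerC hornerX.
    rewrite mulrCA -exprMn; apply/eqXnMl/eqXnX; rewrite mulrBr mulr1.
    by apply: eqXnB => //; apply: eqXn_refl.
  have -> : f0.[A N] + s N * f1.[A N]
     = \sum_(i <- r) (if odd (i2 i) then s N else 1) * (term i).[A N]
     - G.[A N] * (1 - s N) ^+ e.
    rewrite /f0 /f1 !hornerD hornerN !horner_sum mulrDr mulr_sumr.
    rewrite addrACA -big_split /=; congr (_ + _).
      apply: eq_bigr => i _; case: ifP => _; rewrite ?horner0 ?mul1r ?mulr0 ?addr0 //.
      by rewrite add0r.
    by case: (e); rewrite ?horner0 ?mulr0 ?expr0 ?expr1; ring.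
  rewrite -[X in eqXn N _ X](subrr rhs); apply: eqXnB; last first.
    rewrite /rhs [b ^+ k * _]mulrA; apply: eqXnM; last exact: eqXn_refl.
    exact: eqXn_sym.
  apply: eqXn_trans rel_b; apply: eqXn_sym; rewrite mulr_sumr; apply: eqXn_sum => i.
  have [ci0|/cle le_k] := eqVneq (c i) 0.
    by rewrite /term ci0 !mul0r scale0r horner0 !mulr0; apply: eqXn_refl.
  rewrite hornerZ hornerXn.
  have -> : b ^+ k * (c i * H1 N ^+ i0 i * H2 N ^+ i1 i * s N ^+ i2 i)
     = (c i * b ^+ (k - (i0 i + i1 i))) * ((b * H1 N) ^+ i0 i * (b * H2 N) ^+ i1 i)
        * ((if odd (i2 i) then s N else 1) * (s N ^+ 2) ^+ (i2 i)./2).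
    have -> : s N ^+ i2 i = (if odd (i2 i) then s N else 1) * (s N ^+ 2) ^+ (i2 i)./2.
      rewrite -[in LHS](odd_double_half (i2 i)) exprD -exprM mul2n.
      by case: (odd _); rewrite ?expr1 ?expr0.
    rewrite -{1}(subnK le_k) exprD exprD !exprMn.
    move: (_ ^+ (i2 i)./2) (if _ then _ else _) => v w.
    move: (b ^+ _) (b ^+ _) (b ^+ _) (H1 N ^+ _) (H2 N ^+ _) => b1 b2 b3 h1 h2.
    ring.
  apply: eqXn_trans (_ : eqXn N ((c i * b ^+ (k - (i0 i + i1 i))) * ((g1 * A N) ^+ i0 i
     * (g2 * A N) ^+ i1 i) * ((if odd (i2 i) then s N else 1) * lin ^+ (i2 i)./2)) _).
    apply: eqXnM; last by apply/eqXnMl/eqXnX.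
    by apply/eqXnMl/eqXnM; apply: eqXnX.
  apply: eq_eqXn; rewrite !exprMn exprD.
  move: (lin ^+ _) (if _ then _ else _) => v w.
  move: (b ^+ _) (g1 ^+ _) (g2 ^+ _) (A N ^+ _) (A N ^+ _) => b1 h1 h2 a1 a2.
  ring.
have norm0 : f0 ^+ 2 - lin%:P * f1 ^+ 2 = 0.
  apply: A_transc => [|N].
    have size_sqr (f : {poly {poly F}}) : (size f <= k.+1)%N -> (size (f ^+ 2) <= k.*2.+1)%N.
      by move: (size_exp f 2); move: (size (f ^+ 2)) (size f); lia.
    apply: leq_ltn_trans lt_kn; rewrite (leq_trans (size_polyD _ _)) // size_polyN geq_max.
    rewrite size_sqr //= mul_polyC (leq_trans (size_scale_leq _ _)) // size_sqr //.
  have -> : (f0 ^+ 2 - lin%:P * f1 ^+ 2).[A N] = f0.[A N] ^+ 2 - lin * f1.[A N] ^+ 2.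
    by rewrite hornerD hornerN horner_exp hornerM horner_exp hornerC.
  rewrite -[X in _ %| X]subr0 -/(eqXn N _ 0).
  apply: eqXn_trans (_ : eqXn N (f0.[A N] ^+ 2 - s N ^+ 2 * f1.[A N] ^+ 2) 0).
    apply: eqXnB; first exact: eqXn_refl.
    by apply: eqXnM; [apply: eqXn_sym | apply: eqXn_refl].
  have -> : f0.[A N] ^+ 2 - s N ^+ 2 * f1.[A N] ^+ 2
     = (f0.[A N] - s N * f1.[A N]) * (f0.[A N] + s N * f1.[A N]) by ring.
  by rewrite -[X in eqXn N _ X](mulr0 (f0.[A N] - s N * f1.[A N])); apply: eqXnMl.
have [f00 f10] := sqr_norm_eq0 norm0.
(* If i0 + i1 = k, the weight bound leaves only i2 = 0 and e = 1, where the parities differ. *)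
have term_k i : (e == odd (i2 i)) -> (term i)`_k = 0.
  rewrite coefZ coefXn; case: (k =P _) => [kE|_]; last by rewrite mulr0.
  have [-> |/deg_c] := eqVneq (c i) 0; first by rewrite !mul0r.
  by rewrite -kE; case: (e) => /=; case: (i2 i) => [|[|m]] //=; lia.
have : d * g1 ^+ k != 0 by rewrite mulf_neq0 ?expf_neq0.
rewrite -G_k; case: e term_k @f1 {rel deg_c size_f1 fA norm0 cle} f10 => term_k f1 f10.
  have := congr1 (fun f : {poly {poly F}} => f`_k) f10.
  rewrite coefD coef0 coef_sum big1 ?add0r => [->|i _]; first by rewrite eqxx.
  by case: ifP => odd_i; rewrite ?coef0 // term_k // odd_i.
have := congr1 (fun f : {poly {poly F}} => f`_k) f00.
rewrite coefB coef0 coef_sum big1 ?sub0r => [/eqP|i _]; first by rewrite oppr_eq0 => ->.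
by case: ifP => odd_i; rewrite ?coef0 // term_k // odd_i.
Qed.
End NoRelation.

(** * Contiguous relations between H1, H2 and A *)

(** Catalan numbers without division, so that they map to every ring. *)
Definition catn (n : nat) : nat := 'C(n.*2, n) - 'C(n.*2, n.+1).

Lemma catnE n : (n.+1 * catn n = cbin n)%N.
Proof.
rewrite /catn mulnBr mul_bin_left -addnn addnK addnn -mulnBl.
by rewrite subSnn mul1n.
Qed.

Lemma natr_catnE (R : pzRingType) n : n.+1%:R * (catn n)%:R = (cbin n)%:R :> R.
Proof. by rewrite -natrM catnE. Qed.

Lemma natr_cbinS (R : pzRingType) n :
  n.+1%:R * (cbin n.+1)%:R = 2%:R * (2%:R * n%:R + 1) * (cbin n)%:R :> R.
Proof. by rewrite -natrM cbinS !natrM -[n.*2.+1]addn1 natrD -mul2n natrM. Qed.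

(** The coefficients s_n of sqrt(1 - 4t). Those of H1 and H2 at t^(2n) are s_n^2 and s_n Cat_n, so
    all three generators have integer coefficients and reduce modulo p. *)
Definition sqrt14_int (n : nat) : int := if n is m.+1 then - 2%:R * (catn m)%:R else 1.

Lemma sqrt14_intS n :
  n.+1%:R * sqrt14_int n.+1 = (4%:R * n%:R - 2%:R) * sqrt14_int n.
Proof.
case: n => [|m]; first by [].
have m1 : m.+1%:R != 0 :> int by rewrite pnatr_eq0.
apply: (mulfI m1); rewrite /sqrt14_int.
have := natr_cbinS int m; rewrite -natr_catnE -[in RHS]natr_catnE.
rewrite -[m.+2]addn1 -![m.+1]addn1 !natrD.
move: (catn _)%:R (catn _)%:R (m%:R : int) => c0 c1 x E.
transitivity (- 2%:R * ((x + 1) * ((x + 1 + 1) * c1))); first by ring.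
by rewrite E; ring.
Qed.

(* The next three identities express, coefficientwise, the relations H1 =      *)
(* (1 - 16x)(A + 4xA'), xH1' = (1 - 16x)xA' and 12xH2 = 8xH1 + (1 - 16x)xH1'.  *)
Lemma sqrt14_int_sqr n : sqrt14_int n.+1 ^+ 2
  = (4%:R * n%:R + 5%:R) * (cbin n.+1)%:R ^+ 2 - 16%:R * (4%:R * n%:R + 1) * (cbin n)%:R ^+ 2.
Proof.
have m1 : n.+1%:R ^+ 2 != 0 :> int by rewrite expf_neq0 // pnatr_eq0.
apply: (mulfI m1); have := natr_cbinS int n; rewrite /sqrt14_int -(natr_catnE _ n).
rewrite -!natr1; move: (cbin _)%:R (catn _)%:R (n%:R : int) => C c x E.
symmetry; transitivity ((4%:R * x + 5%:R) * ((x + 1) * C) ^+ 2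
  - 16%:R * (4%:R * x + 1) * ((x + 1) * ((x + 1) * c)) ^+ 2); first by ring.
by rewrite E; ring.
Qed.

Lemma sqrt14_int_theta n : n.+1%:R * sqrt14_int n.+1 ^+ 2
  = n.+1%:R * (cbin n.+1)%:R ^+ 2 - 16%:R * n%:R * (cbin n)%:R ^+ 2.
Proof.
have m1 : n.+1%:R != 0 :> int by rewrite pnatr_eq0.
apply: (mulfI m1); have := natr_cbinS int n; rewrite /sqrt14_int -(natr_catnE _ n).
rewrite -!natr1; move: (cbin _)%:R (catn _)%:R (n%:R : int) => C c x E.
symmetry; transitivity (((x + 1) * C) ^+ 2
  - 16%:R * x * (x + 1) * ((x + 1) * c) ^+ 2); first by ring.
by rewrite E; ring.
Qed.

Lemma sqrt14_int_cat n : 12%:R * (sqrt14_int n * (catn n)%:R)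
  = 8%:R * sqrt14_int n ^+ 2 + n.+1%:R * sqrt14_int n.+1 ^+ 2
    - 16%:R * n%:R * sqrt14_int n ^+ 2.
Proof.
have m1 : n.+1%:R != 0 :> int by rewrite pnatr_eq0.
apply: (mulfI m1); have := sqrt14_intS n; rewrite [sqrt14_int n.+1]/= -!natr1.
move: (catn _)%:R (sqrt14_int n) (n%:R : int) => c s x E.
transitivity (- 6%:R * s * ((x + 1) * (- 2%:R * c))); first by ring.
symmetry; transitivity ((x + 1) * (8%:R * s ^+ 2 - 16%:R * x * s ^+ 2)
  + ((x + 1) * (- 2%:R * c)) ^+ 2); first by ring.
by rewrite E; ring.
Qed.

Section ModP.
Variables (F : fieldType) (p : nat) (charFp : p \in [pchar F]).
Hypothesis p_gt3 : (3 < p)%N.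

Let H1x N : {poly F} := \poly_(i < N) (sqrt14_int i ^+ 2)%:~R.
Let H2x N : {poly F} := \poly_(i < N) (sqrt14_int i * (catn i)%:R)%:~R.
Local Notation A := (cbin_poly F).
Local Notation a := (cbin_poly F p).

Let coef_1sub16X (f : {poly F}) i :
  ((1 - 16%:R * 'X) * f)`_i = f`_i - (if i is j.+1 then 16%:R * f`_j else 0).
Proof.
rewrite mulrBl mul1r coefB -polyC_natr -mulrA coefCM coefXM.
by case: i => [|i] //=; rewrite mulr0.
Qed.

Let coef_natM n (f : {poly F}) i : (n%:R * f)`_i = n%:R * f`_i.
Proof. by rewrite -polyC_natr coefCM. Qed.

Lemma H1x_theta0 N :
  eqXn N (H1x N) ((1 - 16%:R * 'X) * (A N + 4%:R * ('X * (A N)^`()))).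
Proof.
apply: eqXn_coef => i lt_iN; rewrite coef_1sub16X.
case: i lt_iN => [|i] lt_iN; rewrite !coefD !coef_natM !coef_Xderiv !coef_poly lt_iN.
  by rewrite mul0r mulr0 addr0 subr0.
rewrite (ltnW lt_iN) sqrt14_int_sqr !(mulrzBr, intrD, intrM, mulrz_nat, mulr1z, natrX, expr2).
rewrite -!natr1; ring.
Qed.

Lemma H1x_theta1 N :
  eqXn N ('X * (H1x N)^`()) ((1 - 16%:R * 'X) * ('X * (A N)^`())).
Proof.
apply: eqXn_coef => i lt_iN; rewrite coef_1sub16X.
case: i lt_iN => [|i] lt_iN; rewrite !coef_Xderiv !coef_poly lt_iN.
  by rewrite !mul0r subr0.
have := congr1 (fun z : int => z%:~R : F) (sqrt14_int_theta i).
rewrite (ltnW lt_iN) !(mulrzBr, intrD, intrM, mulrz_nat, mulr1z, natrX, expr2) => ->.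
ring.
Qed.

Lemma H2x_H1x N : eqXn N (12%:R * ('X * H2x N))
  (8%:R * ('X * H1x N) + (1 - 16%:R * 'X) * ('X * (H1x N)^`())).
Proof.
apply: eqXn_coef => i lt_iN; rewrite coefD coef_1sub16X !coef_natM.
case: i lt_iN => [|i] lt_iN; rewrite !coef_Xderiv !coefXM /=.
  by rewrite !mulr0 !mul0r subr0 addr0.
rewrite !coef_poly lt_iN (ltnW lt_iN).
have := congr1 (fun z : int => z%:~R : F) (sqrt14_int_cat i).
rewrite !(mulrzBr, intrD, intrM, mulrz_nat, mulr1z, natrX, expr2) => ->.
ring.
Qed.

(** The derivative of A^p vanishes modulo p, so A = a A^p gives A' = a' A^p and a A' = a' A.
    Differentiating costs one power of X in the congruence; the factor X restores it. *)
Lemma cbin_poly_logderiv N : eqXn N (a * ('X * (A N)^`())) ('X * a^`() * A N).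
Proof.
have /dvdpP[r rE] := cbin_poly_frob charFp p_gt3 N.
have p_eq0 : p%:R = 0 :> {poly F}.
  by rewrite -polyC_natr (pcharf0 charFp).
have ANE : A N = r * 'X^N + a * A N ^+ p by rewrite -rE subrK.
have dA : (A N)^`() = r^`() * 'X^N + r * ('X^(N.-1) *+ N) + a^`() * A N ^+ p.
  rewrite {1}ANE !derivCE -[X in a * X]mulr_natl p_eq0 mul0r mulr0 addr0.
  by rewrite mulrnAr.
rewrite /eqXn dA {2}ANE.
have XN : 'X * ('X^(N.-1) *+ N) = N%:R * 'X^N :> {poly F}.
  by rewrite mulrnAr mulr_natl; case: N {dA ANE rE} => [|N] //=; rewrite -exprS.
have -> : a * ('X * (r^`() * 'X^N + r * ('X^(N.-1) *+ N) + a^`() * A N ^+ p))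
   - 'X * a^`() * (r * 'X^N + a * A N ^+ p)
   = (a * ('X * r^`()) - 'X * a^`() * r) * 'X^N + a * r * ('X * ('X^(N.-1) *+ N)).
  by move: ('X^(N.-1) *+ N) => u; ring.
by rewrite XN [_ * (N%:R * _)]mulrA -mulrDl dvdp_mull.
Qed.

Let gx : {poly F} := (1 - 16%:R * 'X) * (a + 4%:R * ('X * a^`())).

Lemma H1x_cbin N : eqXn N (a * H1x N) (gx * A N).
Proof.
apply: eqXn_trans (eqXnMl a (H1x_theta0 N)) _.
have -> : a * ((1 - 16%:R * 'X) * (A N + 4%:R * ('X * (A N)^`())))
  = (1 - 16%:R * 'X) * (a * A N + 4%:R * (a * ('X * (A N)^`()))) by ring.
have -> : gx * A N = (1 - 16%:R * 'X) * (a * A N + 4%:R * ('X * a^`() * A N)).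
  by rewrite /gx; ring.
by apply/eqXnMl/eqXnD; [apply: eqXn_refl | apply/eqXnMl/cbin_poly_logderiv].
Qed.

Lemma H2x_cbin N : eqXn N (12%:R * 'X * a * H2x N)
  ((8%:R * 'X * gx + (1 - 16%:R * 'X) ^+ 2 * ('X * a^`())) * A N).
Proof.
have -> : 12%:R * 'X * a * H2x N = a * (12%:R * ('X * H2x N)) by ring.
apply: eqXn_trans (eqXnMl a (H2x_H1x N)) _.
have -> : a * (8%:R * ('X * H1x N) + (1 - 16%:R * 'X) * ('X * (H1x N)^`()))
  = 8%:R * 'X * (a * H1x N) + a * (1 - 16%:R * 'X) * ('X * (H1x N)^`()) by ring.
rewrite [X in eqXn N _ X]mulrDl; apply: eqXnD.
  by rewrite -[8%:R * 'X * _ * _]mulrA; apply/eqXnMl/H1x_cbin.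
apply: eqXn_trans (eqXnMl _ (H1x_theta1 N)) _.
have -> : a * (1 - 16%:R * 'X) * ((1 - 16%:R * 'X) * ('X * (A N)^`()))
  = (1 - 16%:R * 'X) ^+ 2 * (a * ('X * (A N)^`())) by ring.
by rewrite -[_ ^+ 2 * _ * _]mulrA; apply/eqXnMl/cbin_poly_logderiv.
Qed.

(** The passage from x to t = sqrt x is needed to accommodate sqrt(1 - 4t). The polynomial a(t^2)
    stays squarefree because a(0) = 1 and p is odd. *)
Lemma cbin_poly_comp_transc (f : {poly {poly F}}) : (size f < p)%N ->
  (forall N, 'X^N %| f.[A N \Po 'X^2]) -> f = 0.
Proof.
have cop0 N : (0 < N)%N -> coprimep 'X (A N \Po 'X^2).
  move=> N_gt0; rewrite coprimep_sym.
  have := coprimep_XsubC (A N \Po 'X^2) 0; rewrite polyC0 subr0 => ->.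
  rewrite /root horner_coef0 coef_comp_poly_Xn // dvdn0 div0n coef_poly N_gt0.
  exact: oner_neq0.
apply: (transcendental_below charFp (a := a \Po 'X^2)).
- have q_gt0 : (0 < p./2)%N by lia.
  have := size_comp_poly a 'X^2.
  rewrite size_polyXn (size_cbin_poly charFp p_gt3) !succnK; move: (size _) => m.
  by lia.
- rewrite deriv_comp coprimepMr coprimep_comp_poly ?cbin_poly_coprime_deriv //=.
  rewrite derivXn expr1 -mulr_natl -polyC_natr mul_polyC coprimepZr; last first.
    rewrite -(dvdn_pcharf charFp); apply/negP => /dvdn_leq; lia.
  rewrite coprimep_sym cop0 //; lia.
- by case=> [|N]; rewrite ?coprime1p // coprimep_expl // cop0.
move=> N; have := eqXn_comp (cbin_poly_frob charFp p_gt3 N).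
by rewrite comp_polyM rmorphXn.
Qed.

Lemma no_relation_modp (s : nat -> {poly F}) (I : Type) (r : seq I)
    (i0 i1 i2 : I -> nat) (c : I -> {poly F}) (d : {poly F}) (k : nat) (e : bool) :
    (forall N, eqXn N (s N ^+ 2) (1 - 4%:R * 'X)) ->
    (k.*2.+1 < p)%N -> d != 0 ->
    (forall i, c i != 0 -> (2 * (i0 i + i1 i) + i2 i < 2 * k + e)%N) ->
  ~ (forall N, eqXn N (\sum_(i <- r) c i * (H1x N \Po 'X^2) ^+ i0 i
        * (H2x N \Po 'X^2) ^+ i1 i * s N ^+ i2 i)
      (d * ((H1x N \Po 'X^2) - 1) ^+ k * (1 - s N) ^+ e)).
Proof.
move=> s_sqr lt_kp d_neq0 deg_c.
(* The common denominator of H1 and H2 as multiples of A. *)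
pose b : {poly F} := 12%:R * 'X * a.
have b_H1 N : eqXn N ((b \Po 'X^2) * (H1x N \Po 'X^2))
                     ((12%:R * 'X * gx \Po 'X^2) * (A N \Po 'X^2)).
  rewrite -!comp_polyM; apply: eqXn_comp.
  rewrite -[12%:R * 'X * gx * _]mulrA -[b * _]mulrA.
  by apply: eqXnMl; apply: H1x_cbin.
have b_H2 N : eqXn N ((b \Po 'X^2) * (H2x N \Po 'X^2)) ((8%:R * 'X * gx
    + (1 - 16%:R * 'X) ^+ 2 * ('X * a^`()) \Po 'X^2) * (A N \Po 'X^2)).
  by rewrite -!comp_polyM; apply/eqXn_comp/H2x_cbin.
have natF_neq0 n : (n%:R != 0 :> F) = ~~ (p %| n)%N by rewrite (dvdn_pcharf charFp).
have p_pr := pcharf_prime charFp.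
have gx_neq0 : gx != 0.
  apply/eqP => /(congr1 (fun f : {poly F} => f`_0)).
  rewrite coef0 coef_1sub16X subr0 coefD coef_natM coefXM mulr0 addr0 coef_poly.
  by rewrite ifT; [move/eqP; rewrite oner_eq0 | lia].
have g1_neq0 : 12%:R * 'X * gx \Po 'X^2 != 0.
  rewrite comp_poly_eq0 ?size_polyXn // mulf_neq0 // mulf_neq0 ?polyX_eq0 //.
  rewrite -polyC_natr polyC_eq0 natF_neq0 -[12%N]/(2 ^ 2 * 3)%N Euclid_dvdM //.
  rewrite Euclid_dvdX // andbT negb_or.
  by apply/andP; split; apply/negP => /dvdn_leq; lia.
apply: (no_relation cbin_poly_comp_transc g1_neq0 b_H1 b_H2 s_sqr) => //.
rewrite natF_neq0 -[4%N]/(2 ^ 2)%N Euclid_dvdX // andbT.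
by apply/negP => /dvdn_leq; lia.
Qed.
End ModP.

(** * From Laurent series over Q to polynomials modulo p *)

Lemma fcoef_sqrt14 n : fcoef sqrt14 n = (sqrt14_int n)%:~R.
Proof.
elim: n => [|n IHn]; first exact: fcoef_sqrt14_0.
have n1 : n.+1%:R != 0 :> rat by rewrite pnatr_eq0.
apply: (mulfI n1); rewrite sqrt14_rec IHn.
have /(congr1 (fun z : int => z%:~R : rat)) := sqrt14_intS n.
by rewrite !(intrM, mulrzBr, mulrz_nat) => <-.
Qed.

Lemma CatE n : Cat n = (catn n)%:R.
Proof.
have n1 : n.+1%:R != 0 :> rat by rewrite pnatr_eq0.
by apply: (mulfI n1); rewrite natr_catnE /Cat mulrC divfK.
Qed.

Lemma poch1 n : poch 1 n = (n`!)%:R.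
Proof.
rewrite /poch; elim: n => [|n IHn]; first by rewrite big_ord0.
by rewrite big_ord_recr IHn /= factS natrM nat1r mulrC.
Qed.

Lemma poch2 n : poch 2%:R n = (n.+1`!)%:R.
Proof.
rewrite -poch1 /poch big_ord_recl addr0 mul1r; apply: eq_bigr => i _.
by rewrite lift0 -[i.+1%:R]nat1r addrA.
Qed.

Lemma pochS x n : poch x n.+1 = x * poch (x + 1) n.
Proof.
rewrite /poch big_ord_recl addr0; congr (_ * _); apply: eq_bigr => i _.
by rewrite lift0 -[i.+1%:R]nat1r addrA.
Qed.

Lemma poch_half n : poch (1 / 2%:R) n * 4%:R ^+ n / (n.+1`!)%:R = Cat n.
Proof.
have := fcoef_sqrt14 n.+1; rewrite /= pochS exprS intrM CatE mulrz_nat.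
rewrite (_ : - (1 / 2%:R) + 1 = 1 / 2%:R :> rat); last by field.
have f_neq0 : (n.+1`!)%:R != 0 :> rat by rewrite pnatr_eq0 -lt0n fact_gt0.
move: (poch _ n) (_%:R ^+ n) (catn n)%:R ((n.+1)`!)%:R f_neq0 => x y c f f_neq0.
rewrite (_ : (- 2%:R)%:~R = - 2%:R :> rat) // => E.
apply: (@mulfI _ (- 2%:R)); first by rewrite oppr_eq0 pnatr_eq0.
by rewrite -E; field.
Qed.

Lemma fcoef_H1 n : fcoef H1 n = if odd n then 0 else (sqrt14_int n./2 ^+ 2)%:~R.
Proof.
rewrite /=; case: ifP => // _; move: n./2 => {}n.
rewrite expr2 intrM -fcoef_sqrt14 /= /hyp2F1_coef poch1.
have f_neq0 : (n`!)%:R != 0 :> rat by rewrite pnatr_eq0 -lt0n fact_gt0.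
by rewrite (_ : 16%:R = 4%:R * 4%:R) // exprMn; field.
Qed.

Lemma fcoef_H2 n :
  fcoef H2 n = if odd n then 0 else (sqrt14_int n./2 * (catn n./2)%:R)%:~R.
Proof.
rewrite /=; case: ifP => // _; move: n./2 => {}n.
rewrite intrM mulrz_nat -fcoef_sqrt14 -CatE -poch_half /= /hyp2F1_coef poch2.
have f_neq0 : (n`!)%:R != 0 :> rat by rewrite pnatr_eq0 -lt0n fact_gt0.
have f1_neq0 : (n.+1`!)%:R != 0 :> rat by rewrite pnatr_eq0 -lt0n fact_gt0.
by rewrite (_ : 16%:R = 4%:R * 4%:R) // exprMn; field; rewrite ?f_neq0 ?f1_neq0.
Qed.

(** * The Catalan series and the generators *)

Definition catalan_series : fps := FPS Cat.
Definition catalan_sqr_series : fps :=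
  FPS (fun n => if odd n then 0 else Cat n./2 ^+ 2).

Lemma fps_poly_is_zmod_morphism : zmod_morphism fps_poly.
Proof. by move=> p q; apply/fpsP => n; rewrite /= coefB. Qed.

Lemma fps_poly_is_monoid_morphism : monoid_morphism fps_poly.
Proof. by split=> // p q; apply/fpsP => n; rewrite /= coefM. Qed.

HB.instance Definition _ :=
  GRing.isZmodMorphism.Build {poly rat} fps fps_poly fps_poly_is_zmod_morphism.
HB.instance Definition _ :=
  GRing.isMonoidMorphism.Build {poly rat} fps fps_poly fps_poly_is_monoid_morphism.

Lemma fcoef_monM c m f n : fcoef (fps_poly (c *: 'X^m) * f) n =
  if (n < m)%N then 0 else c * fcoef f (n - m).
Proof.
rewrite fcoefM; case: ltnP => [lt_nm | le_mn].
  apply: big1 => i _; rewrite /= coefZ coefXn ltn_eqF ?mulr0 ?mul0r //.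
  exact: leq_ltn_trans (leq_ord i) lt_nm.
have lt_mn : (m < n.+1)%N by [].
rewrite (bigD1 (Ordinal lt_mn)) //= coefZ coefXn eqxx mulr1 big1 ?addr0 // => i.
by rewrite -val_eqE /= coefZ coefXn => /negPf->; rewrite mulr0 mul0r.
Qed.

Lemma sqrt14_int_Cat n : (sqrt14_int n.+1)%:~R = - 2%:R * Cat n :> rat.
Proof. by rewrite CatE [LHS]intrM mulrz_nat. Qed.

Lemma H1_catalan : H1 - 1 = fps_poly (4%:R *: 'X^2) * catalan_sqr_series.
Proof.
apply/fpsP => n; rewrite fcoef_monM fcoefD fcoefN fcoef_H1 fcoef1 [fcoef _ _]/=.
case: n => [|[|n]] //; rewrite subr0 !subSS subn0 2!oddS negbK.
case: ifP => _; first by rewrite mulr0.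
by rewrite expr2 intrM [n.+2./2]/= sqrt14_int_Cat; ring.
Qed.

Lemma sqrt14_catalan : 1 - sqrt14 = fps_poly (2%:R *: 'X^1) * catalan_series.
Proof.
apply/fpsP => n; rewrite fcoef_monM fcoefD fcoefN fcoef_sqrt14 fcoef1 [fcoef _ _]/=.
case: n => [|n] //; rewrite sub0r subSS subn0 sqrt14_int_Cat.
by rewrite mulNr opprK.
Qed.

(** * Integer approximations of rational power series *)

Definition approx N (z : fps) (f : {poly int}) :=
  forall i, (i < N)%N -> fcoef z i = (f`_i)%:~R.

Lemma approxB N z w f g : approx N z f -> approx N w g -> approx N (z - w) (f - g).
Proof.
by move=> zf wg i lt_iN; rewrite fcoefD fcoefN zf // wg // coefB mulrzBr.
Qed.

Lemma approxD N z w f g : approx N z f -> approx N w g -> approx N (z + w) (f + g).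
Proof. by move=> zf wg i lt_iN; rewrite fcoefD zf // wg // coefD intrD. Qed.

Lemma approxM N z w f g : approx N z f -> approx N w g -> approx N (z * w) (f * g).
Proof.
move=> zf wg i lt_iN; rewrite fcoefM coefM rmorph_sum /=; apply: eq_bigr => j _.
by rewrite intrM zf ?wg // (leq_ltn_trans _ lt_iN) ?leq_subr // -ltnS.
Qed.

Lemma approx_poly N f : approx N (fps_poly (map_poly intr f)) f.
Proof. by move=> i _; rewrite /= coef_map. Qed.

Lemma approx1 N : approx N 1 1.
Proof. by move=> i _; rewrite fcoef1 coef1 mulrz_nat. Qed.

Lemma approxX N z f k : approx N z f -> approx N (z ^+ k) (f ^+ k).
Proof.
by move=> zf; elim: k => [|k IHk]; [apply: approx1 | rewrite !exprS; apply: approxM].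
Qed.

Lemma approx_sum N (I : Type) (r : seq I) (z : I -> fps) f :
  (forall i, approx N (z i) (f i)) ->
  approx N (\sum_(i <- r) z i) (\sum_(i <- r) f i).
Proof.
move=> zf; apply: (big_ind2 (approx N)) => // [|z1 f1 z2 f2]; last exact: approxD.
by move=> i _; rewrite fcoef0 coef0.
Qed.

(** The bridge to characteristic p: z determines the integer coefficients below N, so identities
    between rational series pass to any field. *)
Lemma approx_eqXn (F : fieldType) N z f g : approx N z f -> approx N z g ->
  eqXn N (map_poly intr f : {poly F}) (map_poly intr g).
Proof.
move=> zf zg; apply: eqXn_coef => i lt_iN; rewrite !coef_map /=.
by have := zg i lt_iN; rewrite zf // => /intr_inj->.
Qed.

Lemma approx_even N (z : fps) (c : nat -> int) :
  (forall n, fcoef z n = if odd n then 0 else (c n./2)%:~R) ->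
  approx N z ((\poly_(i < N) c i) \Po 'X^2).
Proof.
move=> zE i lt_iN; rewrite zE coef_comp_poly_Xn // dvdn2 if_neg; case: ifP => // _.
rewrite divn2 coef_poly (leq_ltn_trans _ lt_iN) //; lia.
Qed.

(** * Laurent series and clearing of denominators *)

Lemma to_laurent_inj : injective to_laurent.
Proof. by move=> f g /eqP; rewrite /to_laurent tofrac_eq => /eqP. Qed.

Lemma to_laurentM : {morph to_laurent : f g / f * g}.
Proof. exact: tofracM. Qed.

Lemma to_laurentX f k : to_laurent (f ^+ k) = to_laurent f ^+ k.
Proof. exact: tofracXn. Qed.

Lemma to_laurentB : {morph to_laurent : f g / f - g}.
Proof. exact: tofracB. Qed.

Lemma to_laurent1 : to_laurent 1 = 1.
Proof. exact: tofrac1. Qed.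

Lemma to_laurent_sum (I : Type) (r : seq I) (f : I -> fps) :
  to_laurent (\sum_(i <- r) f i) = \sum_(i <- r) to_laurent (f i).
Proof. exact: (rmorph_sum (@tofrac fps)). Qed.

Lemma tvar_neq0 : tvar != 0.
Proof.
rewrite /tvar /to_laurent tofrac_eq0; apply/eqP => /fpsP/(_ 1%N)/eqP.
by rewrite /= coefX oner_eq0.
Qed.

(** The integer D is kept apart from the power of t because the prime p will have to avoid its
    divisors. *)
Lemma laurent_common_denom (s : seq laurent) :
  (forall x, x \in s -> is_laurent_poly x) ->
  exists (D : int) (M : nat), D != 0 /\ forall x, x \in s ->
    exists c : {poly int}, to_laurent (fps_poly (map_poly intr (D *: 'X^M))) * x
      = to_laurent (fps_poly (map_poly intr c)).
Proof.
elim: s => [|x s IHs] Ls; first by exists 1, 0%N.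
have [y s_y|D [M [D0 cs]]] := IHs; first by apply: Ls; rewrite in_cons s_y orbT.
have /Ls[p [m xE]] := mem_head x s.
have [q [a a0 pE]] := rat_poly_scale p.
exists (D * a), (M + m)%N; split; first by rewrite mulf_neq0.
have DE : map_poly intr ((D * a) *: 'X^(M + m)) = map_poly intr (D *: 'X^M)
    * (a%:~R *: 'X^m) :> {poly rat}.
  rewrite -!mul_polyC exprD !rmorphM /= !map_polyC !map_polyXn /=; ring.
move=> y; rewrite in_cons => /predU1P[->{y}|/cs[c cE]].
  exists (D *: 'X^M * q); rewrite DE xE mulrA.
  apply: (canLR (mulfK (expf_neq0 m tvar_neq0))).
  rewrite /tvar -to_laurentX -!to_laurentM -!(rmorphXn fps_poly) -!(rmorphM fps_poly).
  congr (to_laurent (fps_poly _)); rewrite pE rmorphM /= -!mulrA; congr (_ * _).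
  by rewrite -scalerAl -scalerAr scalerA mulrC mulVf ?intr_eq0 // scale1r commr_polyXn.
exists (a *: 'X^m * c); rewrite DE [map_poly _ _ * _]mulrC rmorphM to_laurentM -mulrA cE.
rewrite -to_laurentM -rmorphM; congr (to_laurent (fps_poly _)).
by rewrite rmorphM /= map_polyZ map_polyXn.
Qed.

Lemma wdeg_term (P : mpoly 3 laurent) m : m \in msupp P ->
  (2 * (m ord0 + m (lift ord0 ord0)) + m (lift ord0 (lift ord0 ord0)) <= wdeg P)%N.
Proof.
move=> Pm; have := @leq_bigmax_seq _ (msupp P) predT
  (fun m => \sum_(i < 3) Bgen_deg i * m i)%N m Pm isT.
by rewrite !big_ord_recl big_ord0 /Bgen_deg !(tnth_nth 0%N) /= mul1n addn0 addnA mulnDr.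
Qed.

Lemma meval_Bgen (P : mpoly 3 laurent) : meval Bgen P =
  \sum_(m <- msupp P) mcoeff m P * to_laurent (H1 ^+ m ord0
     * H2 ^+ m (lift ord0 ord0) * sqrt14 ^+ m (lift ord0 (lift ord0 ord0))).
Proof.
rewrite mevalE; apply: eq_bigr => m _; congr (_ * _).
rewrite !big_ord_recl big_ord0 /Bgen !(tnth_nth 0) /= mulr1.
by rewrite !to_laurentM !to_laurentX mulrA.
Qed.

Lemma map_poly_even (R : nzRingType) N (c : nat -> int) :
  map_poly intr ((\poly_(i < N) c i) \Po 'X^2)
  = (\poly_(i < N) (c i)%:~R) \Po 'X^2 :> {poly R}.
Proof.
rewrite map_comp_poly map_polyXn; congr (_ \Po _).
by apply/polyP => i; rewrite coef_map !coef_poly /=; case: ifP.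
Qed.

Lemma wdeg_lower_bound k (e : bool) P :
  is_expression (to_laurent (catalan_sqr_series ^+ k * catalan_series ^+ e)) P ->
  (2 * k + e <= wdeg P)%N.
Proof.
move=> [P_laurent]; rewrite -/(meval Bgen P) meval_Bgen => P_eq.
rewrite leqNgt; apply/negP => lt_wdeg.
have [|D [M [D_neq0 denoms]]] := @laurent_common_denom [seq mcoeff m P | m <- msupp P].
  by move=> x /mapP[m _ ->]; apply: P_laurent.
have /choice[c cE] m : exists c : {poly int}, m \in msupp P ->
    to_laurent (fps_poly (map_poly intr (D *: 'X^M))) * mcoeff m P
    = to_laurent (fps_poly (map_poly intr c)).
  have [Pm|_] := boolP (m \in msupp P); last by exists 0.
  by have [c cE] := denoms _ (map_f _ Pm); exists c.
(* Absorbs the monomials in H1 - 1 = 4t^2 E and 1 - s = 2t C. *)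
pose u : {poly int} := (4%:R *: 'X^2) ^+ k * (2%:R *: 'X^1) ^+ e.
pose i0 (m : multinom 3) : nat := m ord0.
pose i1 (m : multinom 3) : nat := m (lift ord0 ord0).
pose i2 (m : multinom 3) : nat := m (lift ord0 (lift ord0 ord0)).
have fps_eq : \sum_(m <- msupp P) fps_poly (map_poly intr (c m * u))
      * H1 ^+ i0 m * H2 ^+ i1 m * sqrt14 ^+ i2 m
   = fps_poly (map_poly intr (D *: 'X^M)) * (H1 - 1) ^+ k * (1 - sqrt14) ^+ e.
  apply: to_laurent_inj; rewrite to_laurent_sum.
  have uE : fps_poly (map_poly intr u)
      = fps_poly (4%:R *: 'X^2) ^+ k * fps_poly (2%:R *: 'X^1) ^+ e.
    rewrite rmorphM !rmorphXn /= !map_polyZ !map_polyXn rmorphM !rmorphXn /=.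
    by rewrite !(rmorph_nat intr).
  rewrite H1_catalan sqrt14_catalan !exprMn.
  transitivity (to_laurent (fps_poly (map_poly intr (D *: 'X^M)))
      * to_laurent (fps_poly (map_poly intr u))
      * to_laurent (catalan_sqr_series ^+ k * catalan_series ^+ e)); last first.
    by rewrite -!to_laurentM uE; congr to_laurent; ring.
  rewrite -P_eq mulr_sumr; apply: eq_big_seq => m Pm.
  rewrite [RHS]mulrACA cE // -!to_laurentM; congr to_laurent.
  by rewrite rmorphM rmorphM /= -!mulrA.
(* p > 3 makes 12 invertible, p > 2k + 1 admits a relation of degree 2k, and p > |D| keeps D nonzero
   modulo p. *)
have [p p_gt p_pr] := prime_above (3 + k.*2.+1 + absz D).
have charFp := pchar_Fp p_pr.
pose d : {poly int} := D *: 'X^M.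
(* [c] carries information on the support only; elsewhere the coefficient must be 0 for the weight
   bound. *)
pose cF m : {poly 'F_p} := if m \in msupp P then map_poly intr (c m * u) else 0.
have natF_neq0 (z : int) : z != 0 -> (absz z < p)%N -> z%:~R != 0 :> 'F_p.
  move=> z0 lt_zp; have -> : (z%:~R == 0 :> 'F_p) = ((absz z)%:R == 0 :> 'F_p).
    by case: z {z0 lt_zp} => n; rewrite ?NegzE ?mulrNz ?oppr_eq0.
  by rewrite -(dvdn_pcharf charFp); apply/negP => /dvdn_leq; lia.
have sN N : approx N sqrt14 (\poly_(i < N) sqrt14_int i).
  by move=> i lt_iN; rewrite fcoef_sqrt14 coef_poly lt_iN.
pose c1 i := sqrt14_int i ^+ 2; pose c2 i := sqrt14_int i * (catn i)%:R.
have H1N N : approx N H1 ((\poly_(i < N) c1 i) \Po 'X^2).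
  by apply: approx_even => n; rewrite fcoef_H1.
have H2N N : approx N H2 ((\poly_(i < N) c2 i) \Po 'X^2).
  by apply: approx_even => n; rewrite fcoef_H2.
apply: (@no_relation_modp _ p charFp _ (fun N => map_poly intr (\poly_(i < N) sqrt14_int i))
  _ (msupp P) i0 i1 i2 cF (map_poly intr d) k e).
- lia.
- move=> N; have s2 := approxX 2 (sN N); rewrite sqrt14E in s2.
  have s2' := @approx_poly N (1 - 4%:R *: 'X).
  rewrite rmorphB rmorph1 /= map_polyZ map_polyX in s2'.
  have := approx_eqXn 'F_p s2 s2'; rewrite rmorphXn rmorphB rmorph1 /= map_polyZ map_polyX.
  by rewrite -[_ *: 'X]mul_polyC /= polyC_natr.
- lia.
- apply/negP => /eqP/(congr1 (fun f : {poly _} => f`_M))/eqP.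
  rewrite coef_map coefZ coefXn eqxx mulr1 coef0 /=; apply/negP; apply: natF_neq0 => //.
  by lia.
- move=> m; rewrite /cF; case: ifP => [Pm _|]; last by rewrite eqxx.
  exact: leq_ltn_trans (wdeg_term Pm) lt_wdeg.
move=> N; rewrite -!map_poly_even.
have LHS_N : approx N (\sum_(m <- msupp P) fps_poly (map_poly intr (c m * u))
    * H1 ^+ i0 m * H2 ^+ i1 m * sqrt14 ^+ i2 m)
  (\sum_(m <- msupp P) c m * u * ((\poly_(i < N) c1 i) \Po 'X^2) ^+ i0 m
    * ((\poly_(i < N) c2 i) \Po 'X^2) ^+ i1 m * (\poly_(i < N) sqrt14_int i) ^+ i2 m).
  apply: approx_sum => m; do 3!(apply: approxM; last exact: approxX).
  exact: approx_poly.
have RHS_N : approx N (fps_poly (map_poly intr d) * (H1 - 1) ^+ k * (1 - sqrt14) ^+ e)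
  (d * ((\poly_(i < N) c1 i) \Po 'X^2 - 1) ^+ k * (1 - \poly_(i < N) sqrt14_int i) ^+ e).
  apply: approxM; first apply: approxM; first exact: approx_poly.
    by apply/approxX/approxB; last exact: approx1.
  by apply/approxX/approxB; first exact: approx1.
rewrite fps_eq in LHS_N; have := approx_eqXn 'F_p LHS_N RHS_N.
rewrite rmorph_sum !rmorphM !rmorphXn !rmorphB rmorph1 /=.
apply: eq_ind; congr (eqXn _ _ _); apply: eq_big_seq => m Pm.
by rewrite /cF Pm !rmorphM !rmorphXn.
Qed.

(** * Expression of minimal weight *)

Lemma to_laurentD : {morph to_laurent : f g / f + g}.
Proof. exact: tofracD. Qed.

Lemma is_laurent_polyD x y :
  is_laurent_poly x -> is_laurent_poly y -> is_laurent_poly (x + y).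
Proof.
move=> [p [m ->]] [q [n ->]]; exists (p * 'X^n + q * 'X^m), (m + n)%N.
rewrite (rmorphD fps_poly) !(rmorphM fps_poly) !(rmorphXn fps_poly).
rewrite to_laurentD !to_laurentM !to_laurentX -!/tvar.
have := expf_neq0 m tvar_neq0; have := expf_neq0 n tvar_neq0; rewrite exprD.
move: (tvar ^+ m) (tvar ^+ n) (to_laurent _) (to_laurent _) => a b f g b0 a0.
by rewrite addf_div.
Qed.

Lemma is_laurent_polyM x y :
  is_laurent_poly x -> is_laurent_poly y -> is_laurent_poly (x * y).
Proof.
move=> [p [m ->]] [q [n ->]]; exists (p * q), (m + n)%N.
by rewrite mulrACA -to_laurentM -rmorphM -invfM exprD.
Qed.

Lemma is_laurent_poly_poly p : is_laurent_poly (to_laurent (fps_poly p)).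
Proof. by exists p, 0%N; rewrite expr0 divr1. Qed.

Lemma is_laurent_poly_int (z : int) : is_laurent_poly z%:~R.
Proof.
have -> : z%:~R = to_laurent (fps_poly z%:~R) :> laurent.
  by rewrite rmorph_int /to_laurent rmorph_int.
exact: is_laurent_poly_poly.
Qed.

Definition mweight (m : multinom 3) : nat := (\sum_(i < 3) Bgen_deg i * m i)%N.

Definition weight_le d (P : mpoly 3 laurent) :=
  (forall m, is_laurent_poly (mcoeff m P)) /\
  (forall m, m \in msupp P -> (mweight m <= d)%N).

Lemma weight_le1 : weight_le 0 1.
Proof.
split=> m; rewrite ?mcoeff1; first exact: (is_laurent_poly_int (m == mnm0)).
rewrite msupp1 inE => /eqP->; rewrite /mweight big1 // => i _.
by rewrite mnm0E muln0.
Qed.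

Lemma weight_leM d1 d2 P Q :
  weight_le d1 P -> weight_le d2 Q -> weight_le (d1 + d2) (P * Q).
Proof.
move=> [LP wP] [LQ wQ]; split=> m.
  rewrite mcoeffM; apply: (big_ind is_laurent_poly).
  - exact: (is_laurent_poly_int 0).
  - exact: is_laurent_polyD.
  - by move=> i _; apply: is_laurent_polyM.
move=> /msuppM_le/allpairsP[[m1 m2] /= [/wP le1 /wQ le2 ->]].
apply: leq_trans (leq_add le1 le2).
by rewrite /mweight -big_split; apply: leq_sum => i _ /=; rewrite mnmDE mulnDr.
Qed.

Lemma weight_leX d P k : weight_le d P -> weight_le (k * d) (P ^+ k).
Proof.
move=> wP; elim: k => [|k IHk]; first exact: weight_le1.
by rewrite exprS mulSn; apply: weight_leM.
Qed.

Lemma weight_le_linear i c (a b : int) : is_laurent_poly c ->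
  weight_le (Bgen_deg i) (c *: (a%:~R *: mpolyX laurent (mnm1 i) + b%:~R *: 1)).
Proof.
move=> Lc; split=> m.
  rewrite mcoeffZ mcoeffD !mcoeffZ mcoeffX mcoeff1; apply: is_laurent_polyM => //.
  apply: is_laurent_polyD; apply: is_laurent_polyM; try exact: is_laurent_poly_int.
    exact: (is_laurent_poly_int (mnm1 i == m)).
  exact: (is_laurent_poly_int (m == mnm0)).
rewrite mcoeff_msupp mcoeffZ mcoeffD !mcoeffZ mcoeffX mcoeff1.
have [<- _|_] := eqVneq (mnm1 i) m.
  rewrite /mweight (bigD1 i) //= mnm1E eqxx muln1 big1 ?addn0 // => j ne_ji.
  by rewrite mnm1E eq_sym (negPf ne_ji) muln0.
have [-> _|_] := eqVneq m mnm0; last by rewrite !mulr0 addr0 mulr0 eqxx.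
by rewrite /mweight big1 // => j _; rewrite mnm0E muln0.
Qed.

Lemma has_degree_catalan k (e : bool) :
  has_degree (to_laurent (catalan_sqr_series ^+ k * catalan_series ^+ e)) (2 * k + e).
Proof.
split; last exact: wdeg_lower_bound.
pose i2 : 'I_3 := lift ord0 (lift ord0 ord0).
pose inv_mon n m := to_laurent (fps_poly (n%:R^-1)%:P) / tvar ^+ m.
(* The polynomial (a X_b - a) / (n t^i); the two factors of [P] evaluate to E and C. *)
pose mon n i a b : mpoly 3 laurent :=
  inv_mon n i *: (a%:~R *: mpolyX laurent (mnm1 b) - a%:~R *: 1).
pose P : mpoly 3 laurent := mon 4%N 2%N 1 ord0 ^+ k * mon 2%N 1%N (-1) i2 ^+ e.
have monE n i a b (f g : fps) : (0 < n)%N ->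
    to_laurent f = Bgen b -> a%:~R * (f - 1) = fps_poly (n%:R *: 'X^i) * g ->
    meval Bgen (mon n i a b) = to_laurent g.
  move=> n_gt0 fE gE; have n0 : n%:R != 0 :> rat by rewrite pnatr_eq0 -lt0n.
  rewrite mevalZ mevalB !mevalZ mevalXU meval1 -fE -mulrBr -to_laurent1 -to_laurentB.
  have -> : a%:~R = to_laurent a%:~R :> laurent by rewrite /to_laurent rmorph_int.
  rewrite -to_laurentM gE to_laurentM /inv_mon mulrAC mulrA -to_laurentM -(rmorphM fps_poly).
  have -> : (n%:R^-1)%:P * (n%:R *: 'X^i) = 'X^i :> {poly rat}.
    by rewrite mul_polyC scalerA mulVf // scale1r.
  by rewrite mulrAC (rmorphXn fps_poly) to_laurentX divff ?mul1r // expf_neq0 // tvar_neq0.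
have mon_weight n i (a : int) b : weight_le (Bgen_deg b) (mon n i a b).
  rewrite /mon -scaleNr -mulrNz; apply: weight_le_linear.
  by exists (n%:R^-1)%:P, i.
have PE : is_expression (to_laurent (catalan_sqr_series ^+ k * catalan_series ^+ e)) P.
  have [LP _] := weight_leM (weight_leX k (mon_weight 4%N 2%N 1 ord0))
    (weight_leX e (mon_weight 2%N 1%N (-1) i2)).
  split; first exact: LP.
  rewrite mevalM !rmorphXn /= (monE _ _ _ _ H1 catalan_sqr_series) //.
    rewrite (monE _ _ _ _ sqrt14 catalan_series) //; first by rewrite -!to_laurentX -to_laurentM.
    by rewrite -sqrt14_catalan mulrNz mulr1z mulN1r opprB.
  by rewrite -H1_catalan mul1r.
exists P => //; apply/eqP; rewrite eqn_leq wdeg_lower_bound // andbT.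
have [_ wP] := weight_leM (weight_leX k (mon_weight 4%N 2%N 1 ord0))
  (weight_leX e (mon_weight 2%N 1%N (-1) i2)).
rewrite mulnC -[X in (_ + X)%N]muln1; apply/bigmax_leqP_seq => m Pm _.
exact: wP.
Qed.

(** * The trees *)

(** The root, the pairs ([true] for the white parent, [false] for its black child) and the
    additional white leaves. *)
Definition pvertex (k e : nat) : finType := (unit + ('I_k * bool + 'I_e))%type.

Section PairTree.
Variables k e : nat.
Local Notation V := (pvertex k e).
Implicit Type v : V.

Definition proot : V := inl tt.
Definition white_pair i : V := inr (inl (i, true)).
Definition black_pair i : V := inr (inl (i, false)).
Definition white_leaf j : V := inr (inr j).

Definition ppar v : V := if v is inr (inl (i, false)) then white_pair i else proot.
Definition peps v : color :=
  match v with inl _ => Gray | inr (inl (_, false)) => Black | _ => White end.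
Definition prel v : relsign := if v is inr (inl (_, true)) then RelEq else RelVoid.

Lemma iter2_ppar n v : iter n.+2 ppar v = proot.
Proof.
elim: n => [|n IHn]; last by rewrite iterS IHn.
by case: v => [[]|[[i []]|j]].
Qed.

Lemma ppar_connect v : fconnect ppar v proot.
Proof. by rewrite -(iter2_ppar 0 v) fconnect_iter. Qed.

Definition pair_tree : dtree :=
  @DTree V proot ppar (erefl _) ppar_connect peps prel (fun=> 0).

Lemma fconnect_white_pair v i :
  fconnect ppar v (white_pair i) = (v == white_pair i) || (v == black_pair i).
Proof.
apply/idP/orP => [vi|[/eqP->|/eqP->]]; last 2 first.
- exact: connect0.
- exact: (fconnect_iter ppar 1).
have := iter_findex vi; case: (findex _ _ _) => [|[|n]]; last by rewrite iter2_ppar.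
  by move=> /= ->; left.
by case: v {vi} => [[]|[[j []]|j]] //= [->]; right.
Qed.

Lemma num_nongray_pair_tree : num_nongray pair_tree = (2 * k + e)%N.
Proof.
rewrite /num_nongray -sum1_card big_sumType /= big_pred0 => [|[]] //.
rewrite add0n big_sumType /= (eq_bigl predT) => [|[i []]] //.
by rewrite [X in (_ + X)%N](eq_bigl predT) // !sum1_card card_prod card_bool !card_ord mulnC.
Qed.

Lemma cond_pair_tree (x : pair_tree -> nat) :
  [forall v, cond x v] = [forall i, x (white_pair i) == x (black_pair i)].
Proof.
have cond_pair i : cond (T := pair_tree) x (white_pair i) = (x (white_pair i) == x (black_pair i)).
  rewrite /cond /= (big_pred1 (white_pair i)) => [|v]; last first.
    rewrite /desc /= fconnect_white_pair; case: v => [[]|[[j []]|j]] //=.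
    - by rewrite andbT; apply: orb_idr => /eqP[].
    - by rewrite andbF; apply/esym/negbTE/eqP=> -[].
  rewrite (big_pred1 (black_pair i)) => [|v]; last first.
    rewrite /desc /= fconnect_white_pair; case: v => [[]|[[j []]|j]] //=.
    - by rewrite andbF; apply/esym/negbTE/eqP=> -[].
    - by rewrite andbT; apply: orb_idl => /eqP[].
  by rewrite big1_eq subr_eq0.
apply/forallP/forallP => [cx i|eqx v]; first by rewrite -cond_pair.
case: v => [[]|[[i []]|j]] //.
by have := eqx i; rewrite -cond_pair.
Qed.

Section Count.
Variable N : nat.
Local Notation W := ('I_k + 'I_e)%type.
Let spread (y : {ffun W -> 'I_N.+1}) : {ffun pair_tree -> 'I_N.+1} :=
  [ffun v : V => match v with
    | inl _ => ord0 | inr (inl (i, _)) => y (inl i) | inr (inr j) => y (inr j) end].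
Let gather (x : {ffun pair_tree -> 'I_N.+1}) : {ffun W -> 'I_N.+1} :=
  [ffun u : W => match u with
    | inl i => x (white_pair i) | inr j => x (white_leaf j) end].

Let spreadK : cancel spread gather.
Proof. by move=> y; apply/ffunP => -[i|j]; rewrite !ffunE. Qed.

Let size_of (u : W) := if u is inl _ then 2%N else 1%N.

(** An admissible assignment amounts to one value per pair or leaf; a pair counts it twice and
    contributes the square of a Catalan number. *)
Lemma tree_coef_pair_tree : tree_coef pair_tree N =
  \sum_(y : {ffun W -> 'I_N.+1} | (\sum_u size_of u * y u)%N == N)
    \prod_u Cat (y u) ^+ size_of u.
Proof.
rewrite /tree_coef (reindex_onto spread gather) => [|x]; last first.
  case/and3P => /forallP gray0 _; rewrite cond_pair_tree => /forallP eqx.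
  apply/ffunP => -[[]|[[i b]|j]]; rewrite !ffunE //.
    by have /eqP-> := gray0 proot.
  by case: b; rewrite // ; apply/val_inj/eqP; exact: eqx.
apply: eq_big => [y|y _].
  rewrite spreadK eqxx andbT cond_pair_tree.
  have -> : [forall v, is_gray (eps v) ==> (spread y v == ord0)].
    by apply/forallP => -[[]|[[i []]|j]] //=; rewrite ffunE.
  have -> : [forall i, (spread y (white_pair i) : nat) == spread y (black_pair i)].
    by apply/forallP => i; rewrite !ffunE.
  rewrite andbT /=; congr (_ == _).
  rewrite [LHS]big_sumType [X in (_ + X)%N = _]big_sumType [RHS]big_sumType /=.
  rewrite big1 ?add0n => [|[] _]; last by rewrite ffunE.
  congr (_ + _)%N; last by apply: eq_bigr => j _; rewrite ffunE mul1n.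
  rewrite (eq_bigr (fun p => nat_of_ord (y (inl p.1)))) => [|[i b] _]; last by rewrite ffunE.
  rewrite -(pair_bigA _ (fun i _ => nat_of_ord (y (inl i)))) /=.
  by apply: eq_bigr => i _; rewrite big_bool /= mulSn mul1n.
rewrite [LHS]big_sumType [X in _ * X = _]big_sumType [RHS]big_sumType /=.
rewrite big_pred0 ?mul1r => [|[]] //; congr (_ * _); last first.
  by apply: eq_bigr => j _; rewrite ffunE.
rewrite (eq_bigl predT) => [|[i []]] //.
rewrite (eq_bigr (fun p => Cat (y (inl p.1)))) => [|[i b] _]; last by rewrite ffunE.
rewrite -(pair_bigA _ (fun i _ => Cat (y (inl i)))) /=.
by apply: eq_bigr => i _; rewrite big_bool.
Qed.

Let cat_poly d : {poly rat} := \sum_(i < N.+1) (Cat i ^+ d) *: 'X^(d * i).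

Lemma tree_coef_pair_tree_poly :
  tree_coef pair_tree N = (cat_poly 2 ^+ k * cat_poly 1 ^+ e)`_N.
Proof.
have -> : cat_poly 2 ^+ k * cat_poly 1 ^+ e = \prod_(u : W) cat_poly (size_of u).
  by rewrite big_sumType /= !prodr_const !card_ord.
rewrite tree_coef_pair_tree bigA_distr_bigA coef_sum big_mkcond /=.
apply: eq_bigr => y _.
have -> : \prod_u ((Cat (y u) ^+ size_of u) *: 'X^(size_of u * y u))
   = (\prod_u Cat (y u) ^+ size_of u) *: 'X^(\sum_u size_of u * y u)%N :> {poly rat}.
  apply: (big_rec3 (fun n c (f : {poly rat}) => f = c *: 'X^n)) => [|u n c f _ ->].
    by rewrite expr0 scale1r.
  by rewrite -scalerAl -scalerAr scalerA exprD.
by rewrite coefZ coefXn eq_sym; case: eqP; rewrite ?mulr1 ?mulr0.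
Qed.

Lemma fcoef_truncX z (f : {poly rat}) m :
  (forall i, (i <= N)%N -> fcoef z i = f`_i) ->
  forall i, (i <= N)%N -> fcoef (z ^+ m) i = (f ^+ m)`_i.
Proof.
move=> zf; elim: m => [|m IHm] i le_iN; first by rewrite fcoef1 coef1.
rewrite !exprS fcoefM coefM; apply: eq_bigr => j _.
by rewrite zf ?IHm // (leq_trans _ le_iN) ?leq_subr // -ltnS.
Qed.

Lemma coef_cat_poly d i : (0 < d)%N -> (i <= N)%N ->
  (cat_poly d)`_i = if (d %| i)%N then Cat (i %/ d) ^+ d else 0.
Proof.
move=> d_gt0 le_iN; rewrite coef_sum; case: ifP => [/dvdnP[j ij]|ndvd].
  have lt_jN : (j < N.+1)%N by rewrite ltnS (leq_trans _ le_iN) // ij leq_pmulr.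
  rewrite ij mulnK // (bigD1 (Ordinal lt_jN)) //= coefZ coefXn mulnC eqxx mulr1.
  rewrite big1 ?addr0 // => u; rewrite -val_eqE /= coefZ coefXn eqn_pmul2l // eq_sym.
  by move=> /negPf->; rewrite mulr0.
apply: big1 => u _; rewrite coefZ coefXn; case: eqP => [iE|]; last by rewrite mulr0.
by rewrite iE dvdn_mulr in ndvd.
Qed.

End Count.

Lemma tree_series_pair_tree :
  tree_series pair_tree = catalan_sqr_series ^+ k * catalan_series ^+ e.
Proof.
apply/fpsP => N; rewrite [LHS]tree_coef_pair_tree_poly coefM fcoefM.
apply: eq_bigr => i _; have le_iN := leq_ord i.
rewrite -(@fcoef_truncX N catalan_sqr_series) // => [|j le_jN].
  rewrite -(@fcoef_truncX N catalan_series) ?leq_subr // => j le_jN.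
  by rewrite coef_cat_poly // dvd1n divn1 expr1.
by rewrite coef_cat_poly // dvdn2 divn2 /= if_neg.
Qed.

End PairTree.

Local Open Scope classical_set_scope.
Local Open Scope ring_scope.

(** * Values at 1/4 *)

Section Wallis.
Variable R : realType.
Local Notation pi := (pi : R).

(* An antiderivative of [sin ^+ n], by the usual reduction formula; its        *)
(* increment on [0, pi/2] is Wallis' integral.                                 *)
Fixpoint sin_primitive (n : nat) : R -> R :=
  match n with
  | 0 => fun x => x
  | 1 => fun x => - cos x
  | n'.+2 => fun x => (n'.+2%:R)^-1 *
      (n'.+1%:R * sin_primitive n' x - cos x * sin x ^+ n'.+1)
  end.

Lemma is_derive_sin_primitive (n : nat) (x : R) : is_derive x 1 (sin_primitive n) (sin x ^+ n).
Proof.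
elim/ltn_ind: n => -[|[|n]] IHn.
- by rewrite expr0; apply: is_derive_id.
- have := is_deriveN (is_derive_cos x); rewrite opprK expr1; exact.
have dn := IHn n (ltnW (ltnSn _)).
have := is_deriveZ (n.+2%:R^-1) (is_deriveB (is_deriveZ (n.+1%:R) dn)
  (is_deriveM (is_derive_cos x) (is_deriveX n.+1 (is_derive_sin x)))).
rewrite (_ : _ \*: _ = sin_primitive n.+2); last first.
  by apply: funext => y /=; rewrite !functions.fctE.
move/is_derive_eq; apply; rewrite /GRing.scale /= functions.fctE.
have n2 : n.+2%:R != 0 :> R by rewrite pnatr_eq0.
have c2 := cos2Dsin2 x; have {}c2 : cos x ^+ 2 = 1 - sin x ^+ 2 by rewrite -c2 addrK.
apply: (mulfI n2); rewrite mulVKf //.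
transitivity (n.+1%:R * sin x ^+ n - (n.+1%:R * sin x ^+ n * cos x ^+ 2
  - sin x ^+ n.+2)); first by rewrite !exprS; ring.
by rewrite c2 !exprS -!natr1; ring.
Qed.

Definition wallis n : R := sin_primitive n (pi / 2%:R) - sin_primitive n 0.

Lemma wallis0 : wallis 0 = pi / 2%:R. Proof. by rewrite /wallis /= subr0. Qed.

Lemma wallis1 : wallis 1 = 1.
Proof. by rewrite /wallis /= cos_pihalf cos0 opprK oppr0 add0r. Qed.

Lemma wallisSS n : n.+2%:R * wallis n.+2 = n.+1%:R * wallis n.
Proof.
have n2 : n.+2%:R != 0 :> R by rewrite pnatr_eq0.
rewrite /wallis /= sin0 cos_pihalf -mulrBr mulVKf // mul0r exprS mul0r mulr0.
by rewrite !subr0 mulrBr.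
Qed.

(** By the mean value theorem the difference is pi/2 times sin^n - sin^(n+1) at a point of
    [0, pi/2]. *)
Lemma wallis_decr n : wallis n.+1 <= wallis n.
Proof.
have pi2_gt0 : 0 < pi / 2%:R by rewrite divr_gt0 ?pi_gt0.
rewrite -subr_ge0 /wallis.
move: (is_derive_sin_primitive n) (is_derive_sin_primitive n.+1).
move: (sin_primitive n) (sin_primitive n.+1) => f g df dg.
have dF x := is_deriveB (df x) (dg x).
have [|c] := @MVT_segment R _ _ 0 (pi / 2%:R) (ltW pi2_gt0) (fun x _ => dF x).
  apply: derivable_within_continuous => x _.
  by have [] := dF x.
rewrite in_itv => /andP[/= c_ge0 c_le]; rewrite subr0 !functions.fctE => E.
have -> : f (pi / 2%:R) - f 0 - (g (pi / 2%:R) - g 0)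
  = (sin c ^+ n - sin c ^+ n.+1) * (pi / 2%:R) by rewrite -E; ring.
have sin_c : 0 <= sin c.
  rewrite sin_ge0_pi // c_ge0 /=; apply: le_trans c_le _.
  by have := pi_gt0 R; lra.
apply: mulr_ge0; last exact: ltW.
rewrite exprS -{1}[sin c ^+ n]mul1r -mulrBl; apply: mulr_ge0; last exact: exprn_ge0.
by rewrite subr_ge0 sin_le1.
Qed.

Definition bin_ratio n : R := (cbin n)%:R / 4%:R ^+ n.

Lemma bin_ratio_gt0 n : 0 < bin_ratio n.
Proof.
by rewrite divr_gt0 ?exprn_gt0 ?ltr0n // bin_gt0 -addnn leq_addr.
Qed.

Lemma catn_ratio n : n.+1%:R * ((catn n)%:R / 4%:R ^+ n) = bin_ratio n.
Proof. by rewrite mulrA natr_catnE. Qed.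

Lemma bin_ratioS n : 2%:R * n.+1%:R * bin_ratio n.+1 = (2%:R * n%:R + 1) * bin_ratio n.
Proof.
rewrite /bin_ratio exprS; have p4 : 4%:R ^+ n != 0 :> R by rewrite expf_neq0 ?pnatr_eq0.
transitivity (2%:R * (n.+1%:R * (cbin n.+1)%:R) / (4%:R * 4%:R ^+ n) : R).
  by field.
by rewrite natr_cbinS; field.
Qed.

Lemma wallis_even n : wallis n.*2 = pi / 2%:R * bin_ratio n.
Proof.
elim: n => [|n IHn]; first by rewrite wallis0 /bin_ratio /cbin bin0 divr1 mulr1.
have n2 : 2%:R * n.+1%:R != 0 :> R by rewrite -natrM pnatr_eq0.
apply: (mulfI n2); rewrite mulrCA bin_ratioS doubleS -natrM mul2n doubleS wallisSS IHn.
by rewrite -natr1 -mul2n natrM; ring.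
Qed.

Lemma wallis_odd n : wallis n.*2.+1 * ((2%:R * n%:R + 1) * bin_ratio n) = 1.
Proof.
elim: n => [|n IHn]; first by rewrite wallis1 /bin_ratio /cbin bin0 divr1 mulr0 add0r !mulr1.
have n2 : 2%:R * n.+1%:R != 0 :> R by rewrite -natrM pnatr_eq0.
rewrite doubleS; apply: (mulfI n2); have := wallisSS n.*2.+1; have := bin_ratioS n.
move: IHn; rewrite -[n.*2.+3]addn3 -[n.*2.+2]addn2 !(natrD _ n.*2) -mul2n natrM -[n.+1%:R]natr1.
move: (wallis _) (wallis _) (bin_ratio _) (bin_ratio _) (n%:R : R) => w' w b b' x IHn b1 w1.
transitivity ((2%:R * x + 3%:R) * w' * (2%:R * (x + 1) * b)); first by ring.
rewrite w1 b1 mulr1.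
transitivity ((2%:R * x + 2%:R) * (w * ((2%:R * x + 1) * b'))); first by ring.
by rewrite IHn; ring.
Qed.

(* Tends to 4/pi, and sums Cat_l^2 / 16^l by telescoping (Gosper). *)
Definition sqr_ratio n : R := (4%:R * n%:R + 1) * bin_ratio n ^+ 2.

(** Both come from W_(2n+2) <= W_(2n+1) <= W_(2n), where W_(2n) = (pi/2) b_n and W_(2n+1) = 1/((2n +
    1) b_n). *)
Lemma bin_ratio_sqr_bounds n :
  (2%:R / pi <= (2%:R * n%:R + 1) * bin_ratio n ^+ 2) /\
  ((2%:R * n%:R + 1) ^+ 2 * bin_ratio n ^+ 2 <= 4%:R / pi * (n%:R + 1)).
Proof.
have pi_gt0 := pi_gt0 R; have b_gt0 := bin_ratio_gt0 n.
have n_ge0 : 0 <= n%:R :> R by rewrite ler0n.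
have w1 := wallis_decr n.*2; have w2 := wallis_decr n.*2.+1.
have w3 := wallis_even n.+1; rewrite doubleS in w3; rewrite w3 {w3} in w2.
have := wallis_odd n; have := bin_ratioS n; rewrite wallis_even in w1.
move: w1 w2; rewrite -[n.+1%:R]natr1; move: (wallis _) (bin_ratio n.+1) => w b'.
move: (bin_ratio n) (n%:R : R) n_ge0 b_gt0 => b x x_ge0 b_gt0 w1 w2 b'E wE.
have y_gt0 : 0 < (2%:R * x + 1) * b by apply: mulr_gt0 => //; lra.
split.
  rewrite ler_pdivrMr //.
  have : w * ((2%:R * x + 1) * b) <= pi / 2%:R * b * ((2%:R * x + 1) * b).
    by rewrite ler_pM2r.
  by rewrite wE; lra.
have : pi / 2%:R * b' * ((2%:R * x + 1) * b) <= 1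
  by rewrite -[X in _ <= X]wE ler_pM2r.
move=> le1; rewrite [X in _ <= X]mulrAC ler_pdivlMr //.
have : (2%:R * (x + 1)) * (pi / 2%:R * b' * ((2%:R * x + 1) * b)) <= 2%:R * (x + 1) * 1.
  by rewrite ler_pM2l //; lra.
have -> : (2%:R * (x + 1)) * (pi / 2%:R * b' * ((2%:R * x + 1) * b))
  = pi / 2%:R * (2%:R * (x + 1) * b') * ((2%:R * x + 1) * b) by ring.
by rewrite b'E; lra.
Qed.

Lemma sqr_ratio_bound n : `|sqr_ratio n - 4%:R / pi| <= 4%:R / pi * n.+1%:R^-1.
Proof.
have [lo hi] := bin_ratio_sqr_bounds n; rewrite /sqr_ratio.
have pi_gt0 := pi_gt0 R; have n_ge0 : 0 <= n%:R :> R by rewrite ler0n.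
have ip_gt0 : 0 < pi^-1 by rewrite invr_gt0.
rewrite -[n.+1%:R]natr1 ler_norml; move: lo hi.
move: (bin_ratio n ^+ 2) (n%:R : R) n_ge0 (pi^-1) ip_gt0 => c x x_ge0 ip ip_gt0 lo hi.
have x1_gt0 : 0 < x + 1 by lra.
have c_ge0 : 0 <= c by have y_gt0 : 0 < 2%:R * x + 1; [lra | rewrite -(pmulr_rge0 _ y_gt0); lra].
have xc_ge0 : 0 <= x * c by apply: mulr_ge0.
have x1_neq0 : x + 1 != 0 by rewrite gt_eqF.
apply/andP; split.
  rewrite lerNl opprB lerBlDr -lerBlDl.
  have -> : 4%:R * ip - 4%:R * ip / (x + 1) = 4%:R * ip * x / (x + 1) by field.
  rewrite ler_pdivrMr //.
  have := ler_wpM2l x_ge0 lo; lra.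
rewrite lerBlDr; have -> : 4%:R * ip / (x + 1) + 4%:R * ip
  = 4%:R * ip * (x + 2%:R) / (x + 1) by field.
rewrite ler_pdivlMr //.
have y2_gt0 : 0 < (2%:R * x + 1) ^+ 2 by apply: exprn_gt0; lra.
rewrite -(ler_pM2l y2_gt0).
have z_ge0 : 0 <= (4%:R * x + 1) * (x + 1) by apply: mulr_ge0; lra.
have xi_ge0 : 0 <= x * ip by apply: mulr_ge0 => //; lra.
have xxi_ge0 : 0 <= x * (x * ip) by apply: mulr_ge0.
have := ler_wpM2l z_ge0 hi; lra.
Qed.

Lemma bin_ratio_sqr_bound n : bin_ratio n ^+ 2 <= 4%:R / pi * n.+1%:R^-1.
Proof.
have [lo hi] := bin_ratio_sqr_bounds n.
have pi_gt0 := pi_gt0 R; have n_ge0 : 0 <= n%:R :> R by rewrite ler0n.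
have c_ge0 := sqr_ge0 (bin_ratio n).
rewrite -[n.+1%:R]natr1; move: lo hi c_ge0.
move: (bin_ratio n ^+ 2) (n%:R : R) n_ge0 (4%:R / pi) => c x x_ge0 ip lo hi c_ge0.
have x1_gt0 : 0 < x + 1 by lra.
rewrite ler_pdivlMr // -(ler_pM2r x1_gt0); apply: le_trans hi.
have xc_ge0 : 0 <= x * c by apply: mulr_ge0.
have xxc_ge0 : 0 <= x * (x * c) by apply: mulr_ge0.
lra.
Qed.

Lemma cvg_harmonic_bound (u : nat -> R) (l c : R) :
  (forall n, `|u n - l| <= c * n.+1%:R^-1) -> u @ \oo --> l.
Proof.
move=> u_le; apply/subr_cvg0/norm_cvg0P.
have c_harm : (fun n : nat => c * harmonic n) @ \oo --> (0 : R).
  by rewrite -(mulr0 c); apply: cvgM; [exact: cvg_cst | exact: cvg_harmonic].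
apply: (@squeeze_cvgr _ _ _ _ (fun=> 0) (fun n : nat => c * harmonic n)) => //; last exact: cvg_cst.
by apply: nearW => n; rewrite normr_ge0 /= u_le.
Qed.

Lemma cvg_bin_ratio : bin_ratio @ \oo --> (0 : R).
Proof.
have b2 : (fun n => bin_ratio n ^+ 2) @ \oo --> (0 : R).
  apply: (@cvg_harmonic_bound _ _ (4%:R / pi)) => n.
  by rewrite subr0 ger0_norm ?sqr_ge0 // bin_ratio_sqr_bound.
apply/cvgr0Pnorm_lt => eps eps_gt0.
have /cvgr0Pnorm_lt/(_ _ (exprn_gt0 2 eps_gt0)) := b2.
apply: filterS => n; rewrite normrX ltr_pXn2r ?nnegrE ?normr_ge0 //.
exact: ltW.
Qed.

Definition quarter_term (z : fps) (n : nat) : R :=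
  ratr (fcoef z n) * (1 / 4%:R) ^+ n.

(** Telescoping of Cat_n / 4^n = 2 (b_n - b_(n+1)). *)
Lemma series_catalan n : series (quarter_term catalan_series) n = 2%:R - 2%:R * bin_ratio n.
Proof.
elim: n => [|n IHn].
  by rewrite /series /= big_geq // /bin_ratio /cbin bin0 divr1; ring.
rewrite seriesSr IHn /quarter_term /= CatE ratr_nat expr_div_n expr1n mul1r.
have x1 : n.+1%:R != 0 :> R by rewrite pnatr_eq0.
apply: (mulfI x1); have := bin_ratioS n; have := catn_ratio n; rewrite -[n.+1%:R]natr1.
by move: (bin_ratio n) (bin_ratio n.+1) (_ / _) (n%:R : R) => b b' c x <-; lra.
Qed.

Lemma sqr_ratioS n :
  4%:R * sqr_ratio n.+1 = 4%:R * sqr_ratio n + ((catn n)%:R / 4%:R ^+ n) ^+ 2.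
Proof.
have := bin_ratioS n; rewrite /sqr_ratio -(catn_ratio n) -[n.+1%:R]natr1.
have : (n%:R + 1 : R) != 0 by rewrite natr1 pnatr_eq0.
move: (bin_ratio _) (_ / _) (n%:R : R) => b c x x1 bE.
have -> : b = (2%:R * x + 1) * c / 2%:R.
  apply: (mulfI x1); apply: (@mulfI _ 2%:R); first by rewrite pnatr_eq0.
  by rewrite [LHS]mulrA bE; field.
by field.
Qed.

(** Odd powers of t are absent, so the first n terms contain [uphalf n] of the Cat_l^2 / 16^l. *)
Lemma series_catalan_sqr n :
  series (quarter_term catalan_sqr_series) n = 4%:R * (sqr_ratio (uphalf n) - 1).
Proof.
elim: n => [|n IHn].
  by rewrite /series /= big_geq // /sqr_ratio /bin_ratio /cbin bin0 mulr0 divr1; ring.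
rewrite seriesSr IHn /quarter_term [fcoef _ _]/=.
have uphalf1 j : uphalf j.*2.+1 = j.+1 by rewrite /= doubleK.
have uphalf2 j : uphalf j.*2.+2 = j.+1 by rewrite -doubleS uphalf_double.
have [j [->|->]] : exists j, n = j.*2 \/ n = j.*2.+1.
  exists n./2; rewrite -{1 3}(odd_double_half n).
  by case: (odd n); [right | left]; rewrite ?add1n.
  rewrite odd_double uphalf1 uphalf_double doubleK mulrBr [in RHS]mulrBr sqr_ratioS.
  by rewrite rmorphXn /= CatE ratr_nat -mul2n exprM exprAC expr_div_n expr1n -exprMn mul1r; ring.
by rewrite [odd _]/= odd_double uphalf1 uphalf2 rmorph0 mul0r addr0.
Qed.

Lemma cvg_series_catalan : series (quarter_term catalan_series) @ \oo --> (2%:R : R).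
Proof.
rewrite (_ : series _ = (fun n => 2%:R - 2%:R * bin_ratio n)); last first.
  by apply: funext => n; apply: series_catalan.
rewrite -[X in _ --> X](subr0 (2%:R : R)) -[X in _ - X](mulr0 (2%:R : R)).
apply: cvgB; first exact: cvg_cst.
by apply: cvgM; [exact: cvg_cst | exact: cvg_bin_ratio].
Qed.

Lemma cvg_series_catalan_sqr :
  series (quarter_term catalan_sqr_series) @ \oo --> 16%:R / pi - 4%:R.
Proof.
(* The error is at most 4 (4/pi) / ([uphalf n] + 1), and n + 1 <= 2 ([uphalf n] + 1). *)
apply: (@cvg_harmonic_bound _ _ (32%:R / pi)) => n; rewrite series_catalan_sqr.
have -> : 4%:R * (sqr_ratio (uphalf n) - 1) - (16%:R / pi - 4%:R)
  = 4%:R * (sqr_ratio (uphalf n) - 4%:R / pi) by ring.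
rewrite normrM ger0_norm //.
apply: le_trans (ler_wpM2l _ (sqr_ratio_bound _)) _ => //.
have ip_gt0 : 0 < pi^-1 by rewrite invr_gt0 pi_gt0.
have -> : 32%:R / pi * n.+1%:R^-1 = 4%:R * (4%:R / pi * (2%:R * n.+1%:R^-1)) by ring.
rewrite ler_pM2l // ler_pM2l ?mulr_gt0 // ler_pdivlMr ?ltr0n // mulrC.
by rewrite ler_pdivrMr ?ltr0n // -natrM ler_nat;
  have := odd_double_half n; rewrite uphalf_half; lia.
Qed.

End Wallis.

(** * Products of series with nonnegative terms *)

Section CauchyProduct.
Variable R : realType.
Implicit Types a b : nat -> R.

Definition cauchy_prod a b n := \sum_(i < n.+1) a i * b (n - i)%N.

Lemma series_cauchy_prod a b n :
  series (cauchy_prod a b) n = \sum_(i < n) a i * series b (n - i)%N.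
Proof.
elim: n => [|n IHn]; first by rewrite /series /= big_geq // big_ord0.
rewrite seriesSr IHn /cauchy_prod !big_ord_recr /= subnn subSnn seriesSr.
have -> : series b 0 = 0 by rewrite /series /= big_geq.
rewrite add0r addrA -big_split /=; congr (_ + _); apply: eq_bigr => i _.
by rewrite -mulrDr subSn ?(ltnW (ltn_ord i)) // seriesSr.
Qed.

Lemma series_le a m n : (forall i, 0 <= a i) -> (m <= n)%N ->
  series a m <= series a n.
Proof. by move=> a_ge0; apply: nondecreasing_series. Qed.

(** The triangle i + j < n contains the square of side n/2 and lies in the square of side n;
    nonnegativity turns this into a squeeze between products of partial sums. *)
Lemma cvg_cauchy_prod a b (l m : R) :
  (forall i, 0 <= a i) -> (forall i, 0 <= b i) ->
  series a @ \oo --> l -> series b @ \oo --> m ->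
  series (cauchy_prod a b) @ \oo --> l * m.
Proof.
move=> a_ge0 b_ge0 al bm.
have prodE n k : \sum_(i < n) a i * series b k = series a n * series b k.
  by rewrite -mulr_suml; congr (_ * _); rewrite seriesEord.
have ab : (fun n => series a n * series b n) @ \oo --> l * m by apply: cvgM.
have half_oo : half @ \oo --> \oo.
  apply/cvgnyPge => N; exists N.*2 => // n /= le_Nn.
  by move: le_Nn => /= /half_leq; rewrite doubleK.
apply: (squeeze_cvgr _ (cvg_comp _ _ half_oo ab) ab).
apply: nearW => n; rewrite series_cauchy_prod /=; apply/andP; split.
  have le_half : (n./2 <= n)%N by rewrite -{2}(odd_double_half n) -addnn; lia.
  rewrite -prodE -(big_mkord xpredT (fun i => a i * series b n./2)).
  rewrite -(big_mkord xpredT (fun i => a i * series b (n - i)%N)).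
  rewrite (big_cat_nat _ le_half) //= -[X in X <= _]addr0; apply: lerD.
    rewrite !big_mkord; apply: ler_sum => i _; apply: ler_wpM2l => //.
    apply: series_le => //; have := ltn_ord i; have := odd_double_half n; lia.
  apply: sumr_ge0 => i _; apply: mulr_ge0 => //.
  by rewrite seriesEord; apply: sumr_ge0.
rewrite -prodE; apply: ler_sum => i _; apply: ler_wpM2l => //.
by apply: series_le => //; apply: leq_subr.
Qed.

(** Nonnegativity travels with the value, so that values can be multiplied. *)
Definition quarter_value (z : fps) (l : R) :=
  (forall n, 0 <= fcoef z n) /\ series (quarter_term R z) @ \oo --> l.

Lemma quarter_value1 : quarter_value 1 1.
Proof.
split=> [n|]; first by rewrite fcoef1 ler0n.
suff one n : series (quarter_term R 1) n.+1 = 1.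
  by rewrite -cvg_shiftS; apply: cvg_near_cst; apply: nearW.
elim: n => [|n IHn]; rewrite seriesSr.
  by rewrite /series /= big_geq // add0r /quarter_term fcoef1 ratr_nat mulr1.
by rewrite IHn /quarter_term fcoef1 ratr_nat mul0r addr0.
Qed.

Lemma quarter_valueM z w l m :
  quarter_value z l -> quarter_value w m -> quarter_value (z * w) (l * m).
Proof.
move=> [z_ge0 zl] [w_ge0 wm]; split=> [n|].
  by rewrite fcoefM; apply: sumr_ge0 => i _; apply: mulr_ge0.
rewrite (_ : quarter_term R (z * w) = cauchy_prod (quarter_term R z) (quarter_term R w)).
  apply: cvg_cauchy_prod => // n; rewrite /quarter_term mulr_ge0 ?ler0q //;
    by rewrite exprn_ge0 // divr_ge0 // ler0n.
apply: funext => n; rewrite /quarter_term fcoefM rmorph_sum mulr_suml /=.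
by apply: eq_bigr => i _; rewrite rmorphM /= [RHS]mulrACA -exprD subnKC ?leq_ord.
Qed.

Lemma quarter_valueX z l k : quarter_value z l -> quarter_value (z ^+ k) (l ^+ k).
Proof.
move=> zl; elim: k => [|k IHk]; first exact: quarter_value1.
by rewrite !exprS; apply: quarter_valueM.
Qed.

End CauchyProduct.

Lemma Cat_ge0 n : 0 <= Cat n.
Proof. by rewrite CatE ler0n. Qed.

Lemma quarter_value_catalan (R : realType) : quarter_value catalan_series (2%:R : R).
Proof. by split=> [n|]; [apply: Cat_ge0 | apply: cvg_series_catalan]. Qed.

Lemma quarter_value_catalan_sqr (R : realType) :
  quarter_value catalan_sqr_series (16%:R / pi - 4%:R : R).
Proof.
split=> [n|]; last exact: cvg_series_catalan_sqr.
by rewrite /=; case: ifP => // _; rewrite exprn_ge0 ?Cat_ge0.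
Qed.

Theorem proposition25 (R : realType) (n : nat) :
  exists T : dtree,
    [/\ num_nongray T = n,
        has_degree (to_laurent (tree_series T)) n
      & exists p : {poly rat},
          size p = (n./2).+1 /\
          series (fun N : nat => ratr (fcoef (tree_series T) N) * (1 / 4%:R) ^+ N : R)
            @ \oo --> (map_poly ratr p).[(pi : R)^-1] ].
Proof.
have nE : (2 * n./2 + odd n)%N = n by rewrite mul2n addnC odd_double_half.
exists (pair_tree n./2 (odd n)); rewrite tree_series_pair_tree; split.
- by rewrite num_nongray_pair_tree.
- by rewrite -{3}nE; apply: has_degree_catalan.
pose lin : {poly rat} := 16%:R *: 'X - 4%:R%:P.
(* C(1/4) = 2 gives the scalar, and E(1/4) = 16/pi - 4 is [lin] at 1/pi. *)
exists (2%:R ^+ odd n *: lin ^+ n./2).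
have size_lin : size lin = 2%N.
  by rewrite /lin -polyCN -mul_polyC size_MXaddC polyC_eq0 size_polyC.
have lin_neq0 : lin != 0 by rewrite -size_poly_gt0 size_lin.
split.
  rewrite size_scale ?expf_neq0 //.
  by rewrite -[LHS]prednK ?size_poly_gt0 ?expf_neq0 // size_exp size_lin mul1n.
have -> : (map_poly ratr (2%:R ^+ odd n *: lin ^+ n./2)).[pi^-1]
    = (16%:R / pi - 4%:R) ^+ n./2 * 2%:R ^+ odd n :> R.
  rewrite map_polyZ !rmorphXn hornerZ horner_exp rmorphB /= map_polyZ map_polyX map_polyC.
  by rewrite hornerD hornerN hornerZ hornerX hornerC /= !ratr_nat mulrC.
have [_] := quarter_valueM (quarter_valueX n./2 (quarter_value_catalan_sqr R))
  (quarter_valueX (odd n) (quarter_value_catalan R)).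
exact.
Qed.
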